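(* Assume that $\sigma$ is a continuous probability Borel measure on $\mathbb S^1$ and let $p\in\beta\mathbb N$ be idempotent, $p+p=p$. (i) If $p\text{-}\lim_{n\in\mathbb N}\widehat\sigma(ln+k)=0$ for each $l\ge1$ and $k\in\mathbb Z$, then $p\text{-}\lim_{n\in\mathbb N}\widehat\sigma(Q(n))=0$ for each polynomial $Q\in\mathbb Z[x]$ of positive degree. (ii) Let $N\geq 1$. If, for some $P\in\mathcal P_{\le N}$, we have $p\text{-}\lim_{n\in\mathbb N}\widehat\sigma(lP(n)+k)=0$ for each $l\ge1$ and $k\in\mathbb Z$, then $p\text{-}\lim_{n\in\mathbb N}\widehat\sigma(Q(n))=0$ for each $Q\in\mathbb Z[x]$ of degree not smaller than the degree of $P$.
   Context: $\mathbb S^1=\{z\in\mathbb C:|z|=1\}$ and $\mathbb N=\{1,2,\dots\}$. A measure is continuous if it has no atoms. $\widehat\sigma(n)=\int_{\mathbb S^1}z^n\,d\sigma(z)$, $n\in\mathbb Z$. $\mathcal P_{\le N}$ is the additive group of polynomials $P\in\mathbb Z[x]$ with $P(0)=0$ and $\deg P\le N$. $\beta\mathbb N$ is the set of ultrafilters on $\mathbb N$, with addition defined by: $A\in p+q$ iff $\{n\in\mathbb N: A-n\in p\}\in q$, where $A-n=\{y\in\mathbb N: y+n\in A\}$. For a sequence $(x_n)$ in a topological space, $p\text{-}\lim_{n\in\mathbb N}x_n=x$ means that $\{n\in\mathbb N: x_n\in O\}\in p$ for every open neighbourhood $O$ of $x$. *)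

(* Defs.v *)
From HB Require Import structures.
From mathcomp Require Import all_boot all_order all_algebra.
From mathcomp Require Import complex.
From mathcomp Require Import all_classical all_reals all_analysis.

Set Implicit Arguments.
Unset Strict Implicit.
Unset Printing Implicit Defensive.

Import Order.TTheory GRing.Theory Num.Theory.
Import numFieldNormedType.Exports.

Local Open Scope classical_set_scope.
Local Open Scope ring_scope.

(* [R[i]^o] is the field [R[i]] together with the topology of its norm. *)
Definition circle (R : realType) : set R[i]^o := [set z | `|z| = 1].
Arguments circle R : clear implicits.

Definition S1 (R : realType) : Type := set_type (circle R).

Lemma circle1 (R : realType) : (1 : R[i]^o) \in circle R.
Proof. by rewrite inE /circle /= normr1. Qed.

(* [set_type] carries the topology induced by the ambient space. *)
HB.instance Definition _ (R : realType) :=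
  Topological.copy (S1 R) (set_type (circle R)).
(* [g_sigma_algebraType] only applies to pointed types. *)
HB.instance Definition _ (R : realType) :=
  isPointed.Build (S1 R) (exist _ (1 : R[i]^o) (circle1 R)).

Definition borelS1 (R : realType) := g_sigma_algebraType (@open (S1 R)).

(* An atom is a point of positive mass; a Borel probability on the circle has
   one as soon as it has an atom in the sense of measure algebras. *)
Definition continuous_measure (R : realType)
    (sigma : probability (borelS1 R) R) : Prop :=
  forall z : S1 R, sigma [set z] = 0%E.

Definition complex_integral (R : realType) (sigma : probability (borelS1 R) R)
    (f : S1 R -> R[i]) : R[i] :=
  Complex (Rintegral sigma setT (fun z => complex.Re (f z)))
          (Rintegral sigma setT (fun z => complex.Im (f z))).

Definition fourier (R : realType) (sigma : probability (borelS1 R) R)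
    (n : int) : R[i]^o :=
  complex_integral sigma (fun z => (set_val z : R[i]) ^ n).

(* Index set without 0: the principal ultrafilter at 0 would be idempotent. *)
Definition posnat : Type := {n : nat | (0 < n)%N}.

Definition add_posnat (m n : posnat) : posnat :=
  exist _ (val m + val n)%N (ltn_addr (val n) (valP m)).

Definition shift_set (A : set posnat) (n : posnat) : set posnat :=
  [set y | A (add_posnat y n)].

Definition ultra_add (p q : set_system posnat) : set_system posnat :=
  [set A | q [set n | p (shift_set A n)]].

Definition polys_le (N : nat) : set {poly int} :=
  [set P | P.[0] = 0 /\ (size P <= N.+1)%N].

(* Main.v *)
From HB Require Import structures.
Require Import Defs.
From mathcomp Require Import all_boot all_order all_algebra.
From mathcomp Require Import complex.
From mathcomp Require Import all_classical all_reals all_analysis.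
From mathcomp Require Import measurable_realfun ring lra.

Import Order.TTheory GRing.Theory Num.Theory.
Import numFieldNormedType.Exports.

Local Open Scope classical_set_scope.
Local Open Scope ring_scope.

Set Implicit Arguments.
Unset Strict Implicit.
Unset Printing Implicit Defensive.

Local Notation Re := complex.Re.
Local Notation Im := complex.Im.

(** Write z for the coordinate function of the circle and, for an integer
    sequence q, study the weak limits in L^2(sigma) of the unimodular functions
    z^q(n) along the idempotent p.  Part (i) is the case P = X of part (ii).

    Suppose that the Fourier coefficients along Q do not tend to 0.  Then there
    are l >= 1 and a bounded function s with nonzero integral that is rigid:
    z^(l S(n)) s tends to s for every S with S(0) = 0 and deg S <= deg Q
    ([rigid_vector]).  Taking S = P, the integral of z^(l P(n)) s tends to the
    integral of s.  But the hypothesis on P says that all Fourier coefficients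
    of the weak limit phi of z^(l P(n)) vanish, so that the integral of phi s is
    0: a contradiction ([polynomial_decay_transfer]).

    The rigid function is found by induction on deg Q; say Q(0) = 0, and let phi
    be the weak limit of z^Q(n).  By van der Corput's inequality
    ([van_der_corput]), if phi is not 0 then for some h1 <> h2 the sequence
    Q(n + h1) - Q(n + h2), a polynomial of degree one less, has a nonzero weak
    limit too.  Induction gives l and a function r on which z^(l S(n)) acts
    trivially in the limit for all S of degree below deg Q.  For m divisible
    by l, and p contains the set of these m, Q(n + m) - Q(n) - Q(m) is l S(n)
    for such an S; as p + p = p, it follows that phi^2 r = phi r
    ([weak_limit_idempotent]).  So s = phi r satisfies phi s = s: the functions
    z^Q(n) s tend weakly to s, and they have the same norm as s, so they
    converge in norm.

    Weak limits exist as bounded functions by compactness along an ultrafilter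
    and the Radon-Nikodym theorem ([L1_dual], [weak_limit]).  All functions that
    occur are built from characters and their weak limits; such functions
    multiply functions with zero Fourier coefficients into functions of the same
    kind ([cyclic]), and this takes the place of the density of trigonometric
    polynomials. *)

(** * Limits along an ultrafilter *)

Lemma fmap_ultra (I T : Type) (p : set_system I) (f : I -> T) :
  UltraFilter p -> UltraFilter (f @ p).
Proof.
move=> pU; split; first exact: fmap_proper_filter.
move=> G GF fpG; rewrite predeqE => A; split; last exact: fpG.
move=> GA; case: (in_ultra_setVsetC (f @^-1` A) pU) => // pA.
have /(filterI GA) : G (~` A) by exact: fpG.
by rewrite setICr => /filter_not_empty.
Qed.

Lemma ultra_bounded_cvg (R : realType) (I : Type) (p : set_system I)
    (x : I -> R) (M : R) :
  UltraFilter p -> (forall i, `|x i| <= M) -> exists l : R, x i @[i --> p] --> l.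
Proof.
move=> pU xM; have xU := fmap_ultra x pU.
have := @segment_compact R (- M) M; rewrite compact_ultra => /(_ _ xU).
case=> [|l [_ xl]]; last by exists l.
by apply: (@filterE _ p) => i /=; rewrite in_itv /= -ler_norml.
Qed.

Lemma cvg_le_bound (R : realType) (I : Type) (p : set_system I) (x : I -> R)
    {pP : ProperFilter p} (l M : R) :
  x i @[i --> p] --> l -> (\forall i \near p, x i <= M) -> l <= M.
Proof.
by move=> xl xM; exact: (closed_cvg (fun y => y <= M) (@closed_le _ M) xM _ xl).
Qed.

(** * Bounded measurable functions on a probability space *)

Section BoundedMeasurable.
Context d (T : measurableType d) (R : realType) (mu : probability T R).
Implicit Types f g : T -> R.

Definition bounded_measurable f :=
  measurable_fun setT f /\ exists M : R, forall x, `|f x| <= M.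

Local Notation bm := bounded_measurable.
Local Notation E f := (Rintegral mu setT f).

Lemma bm_integrable f : bm f -> mu.-integrable setT (EFin \o f).
Proof.
case=> mf [M fM]; apply: measurable_bounded_integrable => //.
  by rewrite /= probability_setT ltry.
by exists M; split=> [|r Mr x _]; [exact: num_real | exact: le_trans (fM x) (ltW Mr)].
Qed.

Lemma bm_cst c : bm (cst c).
Proof. by split=> //; exists `|c| => x. Qed.

Lemma bmD f g : bm f -> bm g -> bm (f \+ g).
Proof.
case=> mf [M fM] [mg [N gN]]; split; first exact: measurable_funD.
by exists (M + N) => x; apply: le_trans (ler_normD _ _) _; exact: lerD.
Qed.

Lemma bmM f g : bm f -> bm g -> bm (f \* g).
Proof.
case=> mf [M fM] [mg [N gN]]; split; first exact: measurable_funM.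
by exists (M * N) => x; rewrite normrM; exact: ler_pM.
Qed.

Lemma bmN f : bm f -> bm (\- f).
Proof.
case=> mf [M fM]; split; first exact: measurable_funN.
by exists M => x; rewrite normrN.
Qed.

Lemma bmB f g : bm f -> bm g -> bm (f \- g).
Proof. by move=> bf /bmN bg; exact: bmD. Qed.

Lemma bmZ c f : bm f -> bm (fun x => c * f x).
Proof. by move=> bf; exact: bmM (bm_cst c) bf. Qed.

Lemma bm_norm f : bm f -> bm (fun x => `|f x|).
Proof.
case=> mf [M fM]; split; first exact: measurableT_comp.
by exists M => x; rewrite normr_id.
Qed.

Lemma bm_indic A : measurable A -> bm \1_A.
Proof.
move=> mA; split; first exact: measurable_indic.
by exists 1 => x; rewrite indicE; case: (_ \in _); rewrite ?normr1 ?normr0.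
Qed.

Lemma bm_sum n (F : 'I_n -> T -> R) :
  (forall i, bm (F i)) -> bm (fun x => \sum_(i < n) F i x).
Proof.
elim: n F => [|n IHn] F bF.
  rewrite (_ : (fun x => _) = cst 0); first exact: bm_cst.
  by apply/funext => x; rewrite big_ord0.
rewrite (_ : (fun x => _) =
    (fun x => \sum_(i < n) F (widen_ord (leqnSn n) i) x) \+ F ord_max).
  by apply: bmD => //; exact: IHn.
by apply/funext => x; rewrite big_ord_recr.
Qed.

Lemma ED f g : bm f -> bm g -> E (fun x => f x + g x) = E f + E g.
Proof. by move=> bf bg; rewrite RintegralD //; exact: bm_integrable. Qed.

Lemma EB f g : bm f -> bm g -> E (fun x => f x - g x) = E f - E g.
Proof. by move=> bf bg; rewrite RintegralB //; exact: bm_integrable. Qed.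

Lemma EZ c f : bm f -> E (fun x => c * f x) = c * E f.
Proof. by move=> bf; rewrite RintegralZl //; exact: bm_integrable. Qed.

Lemma EN f : bm f -> E (fun x => - f x) = - E f.
Proof.
move=> bf; rewrite -mulN1r -EZ //; congr Rintegral.
by apply/funext => x; rewrite mulN1r.
Qed.

Lemma Ecst c : E (cst c) = c.
Proof. by rewrite Rintegral_cst //= probability_setT mulr1. Qed.

Lemma Esum n (F : 'I_n -> T -> R) : (forall i, bm (F i)) ->
  E (fun x => \sum_(i < n) F i x) = \sum_(i < n) E (F i).
Proof.
elim: n F => [|n IHn] F bF.
  rewrite big_ord0 -[RHS](Ecst 0); congr Rintegral.
  by apply/funext => x; rewrite big_ord0.
rewrite big_ord_recr /= -IHn // -ED //; last exact: bm_sum.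
by congr Rintegral; apply/funext => x; rewrite big_ord_recr.
Qed.

Lemma le_E f g : bm f -> bm g -> (forall x, f x <= g x) -> E f <= E g.
Proof. by move=> bf bg fg; apply: le_Rintegral => //; exact: bm_integrable. Qed.

Lemma E_ge0 f : (forall x, 0 <= f x) -> 0 <= E f.
Proof. by move=> f0; exact: Rintegral_ge0. Qed.

Lemma E_le_norm f : bm f -> `|E f| <= E (fun x => `|f x|).
Proof. by move=> bf; apply: le_normr_Rintegral => //; exact: bm_integrable. Qed.

Lemma E_bound f M : bm f -> (forall x, `|f x| <= M) -> `|E f| <= M.
Proof.
move=> bf fM; rewrite -[leRHS]Ecst; apply: le_trans (E_le_norm bf) _.
by apply: le_E => //; [exact: bm_norm | exact: bm_cst].
Qed.

(** The variance of f is nonnegative. *)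
Lemma E_jensen f : bm f -> E f ^+ 2 <= E (fun x => f x ^+ 2).
Proof.
move=> bf; have bff : bm (fun x => f x ^+ 2) by exact: bmM.
have b2 : bm (fun x => 2 * E f * f x) by exact: bmZ.
have : 0 <= E (fun x => f x ^+ 2 - 2 * E f * f x + E f ^+ 2).
  by apply: E_ge0 => x; have := sqr_ge0 (f x - E f); nra.
rewrite (ED (bmB bff b2) (bm_cst (E f ^+ 2))) EB // EZ // Ecst.
move: (E f) (E (fun x => f x ^+ 2)) => a b H; nra.
Qed.

Lemma E_indic A : measurable A -> E \1_A = fine (mu A).
Proof. by move=> mA; rewrite /Rintegral integral_indic // setIT. Qed.

End BoundedMeasurable.
(** * The dual of L1 and weak limits *)

(** Discretization by thresholds: applied to the values of a bounded function it
    gives a combination of indicators of superlevel sets, see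
    [bm_approx_indic]. *)
Lemma layer_cake (R : realType) (e t : R) (n : nat) :
  0 < e -> 0 <= t -> t <= n%:R * e ->
  let s := \sum_(j < n) e * (j.+1%:R * e <= t)%R%:R in s <= t <= s + e.
Proof.
move=> e0 t0 tn /=; elim: n tn => [|n IHn] tn.
  by rewrite big_ord0; apply/andP; split; lra.
rewrite big_ord_recr /=; have [tn'|tn'] := leP t (n%:R * e).
  have -> : (n.+1%:R * e <= t) = false by rewrite -natr1; apply/negbTE; nra.
  by rewrite mulr0 addr0; exact: IHn.
rewrite (_ : \sum_(j < n) _ = n%:R * e); last first.
  rewrite -[X in X%:R * e]card_ord mulr_natl -sumr_const; apply: eq_bigr => j _.
  suff -> : j.+1%:R * e <= t by rewrite mulr1.
  by apply: ltW; apply: le_lt_trans tn'; rewrite ler_wpM2r ?ler_nat // ltW.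
rewrite -natr1 mulrDl mul1r in tn *.
by case: (leP (n%:R * e + e) t) => h /=; rewrite ?mulr1 ?mulr0; apply/andP; split; lra.
Qed.

Section L1Dual.
Context d (T : measurableType d) (R : realType) (mu : probability T R).
Variable L : (T -> R) -> R.
Local Notation bm := (@bounded_measurable d T R).
Local Notation E f := (Rintegral mu setT f).

Lemma bm_approx_indic g (e : R) : 0 < e -> bm g -> exists n (c b : R) (A : 'I_n -> set T),
  (forall j, measurable (A j)) /\
  forall x, `|g x - (c + \sum_(j < n) b * \1_(A j) x)| <= e.
Proof.
move=> e0 [mg [M gM]].
have [n nM] : exists n, 2 * M <= n%:R * e.
  exists (Num.truncn (2 * M / e)).+1; rewrite -ler_pdivrMr //.
  by apply/ltW/truncnS_gt.
exists n, (- M), e, (fun j => [set x | - M + j.+1%:R * e <= g x]); split=> [j|x].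
  rewrite -[X in measurable X]setTI.
  exact: (measurable_fun_le measurableT (measurable_cst (- M + j.+1%:R * e)) mg).
have gx : 0 <= g x + M <= n%:R * e by have := gM x; rewrite ler_norml; lra.
have /andP[gx0 gxn] := gx.
have := layer_cake e0 gx0 gxn => /=.
under eq_bigr => j _.
  rewrite (_ : (_ <= g x + M) = (x \in [set x | - M + j.+1%:R * e <= g x])); last first.
    by apply/idP/idP => [h|/set_mem /= h]; [apply/mem_set => /=|]; lra.
  rewrite -indicE; over.
by rewrite ler_norml; lra.
Qed.

Hypothesis LD : forall f g, bm f -> bm g -> L (f \+ g) = L f + L g.
Hypothesis LZ : forall c f, bm f -> L (fun x => c * f x) = c * L f.
Hypothesis L_le : forall f, bm f -> `|L f| <= E (fun x => `|f x|).

Let L0 : L (cst 0) = 0.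
Proof.
rewrite (_ : cst 0 = fun x => 0 * cst 0 x) ?LZ ?mul0r //; first exact: bm_cst.
by apply/funext => x; rewrite mul0r.
Qed.

Let LB f g : bm f -> bm g -> L (fun x => f x - g x) = L f - L g.
Proof.
move=> bf bg; rewrite -[- L g]mulN1r -LZ // -LD //; last exact: bmZ.
by congr L; apply/funext => x /=; rewrite mulN1r.
Qed.

Let Lsum n (F : 'I_n -> T -> R) : (forall i, bm (F i)) ->
  L (fun x => \sum_(i < n) F i x) = \sum_(i < n) L (F i).
Proof.
elim: n F => [|n IHn] F bF.
  rewrite big_ord0 -[RHS]L0; congr L.
  by apply/funext => x; rewrite big_ord0.
rewrite big_ord_recr /= -IHn // -LD //; last exact: bm_sum.
by congr L; apply/funext => x; rewrite big_ord_recr.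
Qed.

Let LU A B : measurable A -> measurable B -> A `&` B = set0 ->
  L \1_(A `|` B) = L \1_A + L \1_B.
Proof.
move=> mA mB AB; rewrite -LD; try exact: bm_indic.
congr L; apply/funext => x /=; rewrite !indicE in_setU.
have := in_setI x A B; rewrite AB in_set0.
by case: (x \in A); case: (x \in B) => //= _; rewrite ?addr0 ?add0r.
Qed.

Let L_bigU (F : (set T)^nat) n : (forall i, measurable (F i)) ->
  trivIset setT F ->
  \sum_(i < n) L \1_(F i) = L \1_(\big[setU/set0]_(i < n) F i).
Proof.
move=> mF tF; elim: n => [|n IHn]; first by rewrite !big_ord0 indic0 L0.
rewrite !big_ord_recr /= IHn LU //; first exact: bigsetU_measurable.
apply: (@trivIset_bigsetUI _ predT) => //; exact: sub_trivIset tF.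
Qed.

Let nu (A : set T) : \bar R := (L \1_A)%:E.

(** On a tail of the union, L is at most the measure of the tail. *)
Let nu_sigma_additive : semi_sigma_additive nu.
Proof.
move=> F mF tF mU; pose U n := \big[setU/set0]_(i < n) F i.
have mUn n : measurable (U n) by exact: bigsetU_measurable.
have -> : (fun n => (\sum_(0 <= i < n) nu (F i))%E) = (fun n => (L \1_(U n))%:E).
  by apply/funext => n; rewrite big_mkord sumEFin L_bigU.
apply: cvg_EFin; first exact: nearW.
have cU : fine (mu (U n)) @[n --> \oo] --> fine (mu (\bigcup_n F n)).
  apply: fine_cvg; rewrite fineK ?fin_num_measure //.
  have := @measure_semi_sigma_additive _ _ _ mu _ mF tF mU.
  rewrite (_ : (fun n => _) = (fun n => mu (U n))) //.
  by apply/funext => n; rewrite big_mkord -measure_bigsetU.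
apply/cvgrPdist_le => /= e e0.
near=> n; have : `|fine (mu (\bigcup_n F n)) - fine (mu (U n))| <= e.
  by near: n; exact: cvgr_dist_le cU _ e0.
apply: le_trans; rewrite -LB; try exact: bm_indic.
apply: le_trans (L_le _) _; first by apply: bmB; exact: bm_indic.
apply: le_trans (ler_norm _).
rewrite -!E_indic // -EB; try exact: bm_indic.
rewrite (_ : (fun x => `|_|) = fun x => \1_(\bigcup_n F n) x - \1_(U n) x) //.
apply/funext => x; rewrite ger0_norm // subr_ge0 !indicE ler_nat.
case: (boolP (x \in U n)) => // /set_mem; rewrite /U -bigcup_mkord => -[i _ Fix].
by rewrite mem_set //; exists i.
Unshelve. all: by end_near.
Qed.

Let psi0 : exists f : T -> R, mu.-integrable setT (EFin \o f) /\
  forall A, measurable A -> (\int[mu]_(x in A) (f x)%:E)%E = nu A.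
Proof.
have nu0 : nu set0 = 0%E by rewrite /nu indic0 L0.
have nu_fin A : measurable A -> nu A \is a fin_num by [].
pose c : {charge set T -> \bar R} :=
  HB.pack nu (isCharge.Build _ _ _ nu nu0 nu_fin nu_sigma_additive).
have cmu : c `<< mu.
  apply/null_content_dominatesP => A mA A0 /=.
  suff : `|L \1_A| <= 0 by rewrite normr_le0 => /eqP LA0; rewrite /nu LA0.
  apply: le_trans (L_le (bm_indic R mA)) _.
  rewrite (_ : (fun x => `|_|) = \1_A); last first.
    by apply/funext => x; rewrite ger0_norm.
  by rewrite E_indic // A0.
have fin x := Radon_Nikodym_fin_num x cmu.
exists (fun x => fine (Radon_Nikodym c mu x)).
have -> : EFin \o (fun x => fine (Radon_Nikodym c mu x)) = Radon_Nikodym c mu.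
  by apply/funext => x /=; rewrite fineK.
split=> [|A mA]; first exact: Radon_Nikodym_integrable.
rewrite -[nu A]/(c A) (Radon_Nikodym_integral cmu mA).
by apply: eq_integral => x _; rewrite fineK.
Qed.

(** A functional on L^1 of norm at most 1 is the pairing with a function bounded
    by 1.  Restricted to indicators, L is a charge dominated by mu; its
    Radon-Nikodym derivative stays in [-1, 1] up to a null set, and uniform
    approximation extends the formula from indicators to bounded functions. *)
Lemma L1_dual : exists psi : T -> R, [/\ measurable_fun setT psi,
  forall x, `|psi x| <= 1 & forall f, bm f -> L f = E (fun x => psi x * f x)].
Proof.
have [h [ih hnu]] := psi0.
have mh : measurable_fun setT h by apply/measurable_EFinP; exact: measurable_int ih.
pose psi x := Order.max (- 1) (Order.min 1 (h x)).
have mpsi : measurable_fun setT psi.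
  by apply: measurable_maxr => //; exact: measurable_minr.
have psi1 x : `|psi x| <= 1.
  by rewrite ler_norml /psi le_max ge_max ge_min lexx /= andbT; lra.
have bpsi : bm psi by split=> //; exists 1.
have ipsi := bm_integrable mu bpsi.
have nu_le A : measurable A -> (`|nu A| <= mu A)%E.
  move=> mA; rewrite /nu abse_EFin -[mu A]fineK ?fin_num_measure // lee_fin.
  apply: le_trans (L_le (bm_indic R mA)) _; rewrite -E_indic //.
  rewrite (_ : (fun x => `|_|) = \1_A) //.
  by apply/funext => x; rewrite ger0_norm.
have psi_h : ae_eq mu setT (EFin \o psi) (EFin \o h).
  (* over a measurable subset of {h > 1} the integral of h is at most the
     measure, by the bound on L, and at least the measure; so h = 1 almost
     everywhere on {h > 1}, and likewise h = -1 on {h < -1} *)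
  have iS A : measurable A -> mu.-integrable A (EFin \o h).
    by move=> mA; exact: integrableS ih.
  have icst A (c : R) : measurable A -> mu.-integrable A (EFin \o cst c).
    by move=> mA; exact: finite_measure_integrable_cst.
  have intc A (c : R) : measurable A ->
      (\int[mu]_(x in A) (EFin \o cst c) x = c%:E * mu A)%E.
    by move=> mA; rewrite -[LHS]/(\int[mu]_(x in A) cst c%:E x)%E integral_cst.
  have mB1 : measurable [set x | 1 < h x].
    by rewrite -preimage_itvoy -[X in measurable X]setTI; exact: mh.
  have mB2 : measurable [set x | h x < - 1].
    by rewrite -preimage_itvNyo -[X in measurable X]setTI; exact: mh.
  have H1 : ae_eq mu [set x | 1 < h x] (EFin \o h) (EFin \o cst 1).
    apply: integral_ae_eq => //; [exact: iS | exact/measurable_EFinP |].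
    move=> B BB1 mB; apply: le_anti; apply/andP; split.
      by rewrite hnu // intc // mul1e; apply: le_trans (nu_le _ mB); exact: lee_abs.
    apply: le_integral => //; [exact: icst| exact: iS |].
    by move=> x /set_mem /BB1 /= /ltW; rewrite lee_fin.
  have H2 : ae_eq mu [set x | h x < - 1] (EFin \o h) (EFin \o cst (- 1)).
    apply: integral_ae_eq => //; [exact: iS | exact/measurable_EFinP |].
    move=> B BB2 mB; apply: le_anti; apply/andP; split.
      apply: le_integral => //; [exact: iS | exact: icst |].
      by move=> x /set_mem /BB2 /= /ltW; rewrite lee_fin.
    rewrite hnu // intc // EFinN mulN1e leeNl; apply: le_trans (nu_le _ mB).
    by rewrite -abseN; exact: lee_abs.
  move: H1 H2; apply: filterS2 => x /= h1 h2 _; congr EFin; rewrite /psi.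
  have [lt1|le1] := ltP 1 (h x).
    by case: (h1 lt1) => /= ->; rewrite max_r //; lra.
  by have [ltN|//] := ltP (h x) (-1); case: (h2 ltN) => /= ->.
exists psi; split=> // f bf.
have L_indic A : measurable A -> L \1_A = E (fun x => psi x * \1_A x).
  move=> mA; rewrite -[LHS]/(fine (nu A)) -hnu //.
  rewrite -(@ae_eq_integral _ _ _ mu A (EFin \o h) (EFin \o psi)) //.
  - rewrite -[LHS]/(Rintegral mu A psi) Rintegral_mkcond; congr Rintegral.
    apply/funext => x; rewrite /patch indicE.
    by case: (x \in A); rewrite ?mulr1 ?mulr0.
  - by apply/measurable_EFinP; exact: measurable_funTS.
  - by apply/measurable_EFinP; exact: measurable_funTS.
  - by move: psi_h; apply: filterS => x /= H _; exact: H.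
apply/eqP; rewrite -subr_eq0 -normr_le0; apply/ler_addgt0Pl => e e0; rewrite addr0.
have e2 : 0 < e / 2 by lra.
have [n [c [b [A [mA fA]]]]] := bm_approx_indic e2 bf.
pose g x := c + \sum_(j < n) b * \1_(A j) x.
have bA j : bm (fun x => b * \1_(A j) x) by apply: bmZ; exact: bm_indic.
have bg : bm g by apply: bmD; [exact: bm_cst | exact: bm_sum].
have Lg : L g = E (fun x => psi x * g x).
  have bpA j : bm (fun x => psi x * \1_(A j) x) by apply: bmM => //; exact: bm_indic.
  have LbA j : L (fun x => b * \1_(A j) x) = E (fun x => b * (psi x * \1_(A j) x)).
    by rewrite LZ; [rewrite L_indic // EZ | exact: bm_indic].
  rewrite (_ : g = (fun x => c * \1_setT x) \+
      fun x => \sum_(j < n) b * \1_(A j) x); last first.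
    by apply/funext => x; rewrite /g /= indicE in_setT mulr1.
  rewrite LD; [|apply: bmZ; exact: bm_indic|exact: bm_sum].
  rewrite LZ; last exact: bm_indic.
  rewrite Lsum //.
  rewrite (eq_bigr _ (fun j _ => LbA j)).
  rewrite L_indic // -EZ; last by apply: bmM => //; exact: bm_indic.
  rewrite -Esum; last by move=> j; exact: bmZ.
  rewrite -ED; [|apply: bmZ; apply: bmM => //; exact: bm_indic|].
    congr Rintegral; apply/funext => x; rewrite mulrDr mulrCA; congr (_ + _).
    by rewrite mulr_sumr; apply: eq_bigr => j _; rewrite mulrCA.
  by apply: bm_sum => j; exact: bmZ.
have bfg : bm (fun x => f x - g x) by exact: bmB.
rewrite (_ : L f - _ = L (fun x => f x - g x) - E (fun x => psi x * (f x - g x))).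
  have h1 : `|L (fun x => f x - g x)| <= e / 2.
    apply: le_trans (L_le bfg) _; apply: le_trans (ler_norm _) _.
    by apply: E_bound => [|x]; [exact: bm_norm | rewrite normr_id].
  have h2 : `|E (fun x => psi x * (f x - g x))| <= e / 2.
    apply: E_bound => [|x]; first exact: bmM.
    by rewrite normrM -[leRHS]mul1r ler_pM.
  by move: h1 h2; rewrite !ler_norml; lra.
rewrite LB // Lg.
rewrite (_ : E (fun x => psi x * (f x - g x)) =
  E (fun x => psi x * f x) - E (fun x => psi x * g x)); first by ring.
rewrite -EB; try exact: bmM.
by congr Rintegral; apply/funext => x; rewrite mulrBr.
Qed.

End L1Dual.

(** Compactness of the unit ball of L^infinity: the limits of the pairings exist
    because bounded real sequences converge along p, and they define a functional
    on L^1 of norm at most 1. *)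
Lemma weak_star_limit (d : measure_display) (T : measurableType d) (R : realType)
    (mu : probability T R) (I : Type) (p : set_system I) (u : I -> T -> R) :
  UltraFilter p -> (forall i, measurable_fun setT (u i)) ->
  (forall i x, `|u i x| <= 1) ->
  exists psi : T -> R, bounded_measurable psi /\
    forall g, bounded_measurable g ->
      Rintegral mu setT (fun x => u i x * g x) @[i --> p] -->
      Rintegral mu setT (fun x => psi x * g x).
Proof.
move=> pU mu_ u1.
have bu i : bounded_measurable (u i) by split=> //; exists 1.
pose L g : R := lim (Rintegral mu setT (fun x => u i x * g x) @[i --> p]).
have cL g : bounded_measurable g ->
    Rintegral mu setT (fun x => u i x * g x) @[i --> p] --> L g.
  case=> mg [M gM]; have bg : bounded_measurable g by split=> //; exists M.
  have [i|l xl] := @ultra_bounded_cvg _ _ p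
      (fun i => Rintegral mu setT (fun x => u i x * g x)) M pU.
    apply: E_bound => [|x]; first exact: bmM.
    by rewrite normrM -[leRHS]mul1r ler_pM.
  by rewrite /L (cvg_lim _ xl).
have L_eq g l : Rintegral mu setT (fun x => u i x * g x) @[i --> p] --> l -> L g = l.
  by move=> xl; exact: cvg_lim xl.
have LD f g : bounded_measurable f -> bounded_measurable g -> L (f \+ g) = L f + L g.
  move=> bf bg; apply: L_eq; rewrite (_ : (fun i => _) = fun i =>
    Rintegral mu setT (fun x => u i x * f x) + Rintegral mu setT (fun x => u i x * g x)).
    by apply: cvgD; exact: cL.
  apply/funext => i; rewrite -ED; try exact: bmM.
  by congr Rintegral; apply/funext => x /=; rewrite mulrDr.
have LZ c f : bounded_measurable f -> L (fun x => c * f x) = c * L f.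
  move=> bf; apply: L_eq; rewrite (_ : (fun i => _) = fun i =>
    c * Rintegral mu setT (fun x => u i x * f x)).
    by apply: cvgM; [exact: cvg_cst | exact: cL].
  apply/funext => i; rewrite -EZ; last exact: bmM.
  by congr Rintegral; apply/funext => x /=; rewrite mulrCA.
have L_le f : bounded_measurable f -> `|L f| <= Rintegral mu setT (fun x => `|f x|).
  move=> bf; have cn := cvg_norm (cL f bf).
  apply: (cvg_le_bound (cn _)); apply: nearW => i /=.
  apply: le_trans (E_le_norm _ _) _; first exact: bmM.
  apply: le_E; [by apply: bm_norm; exact: bmM | exact: bm_norm|] => x.
  by rewrite normrM ler_piMl.
have [psi [mpsi psi1 psiE]] := L1_dual LD LZ L_le.
exists psi; split; first by split=> //; exists 1.
by move=> g bg; rewrite -psiE //; exact: cL.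
Qed.

(** * Complex limits and integrals *)

Section ComplexNumbers.
Variable R : realType.
Implicit Types x y z : R[i].

Lemma Re_add x y : Re (x + y) = Re x + Re y. Proof. by case: x y => ? ? []. Qed.
Lemma Im_add x y : Im (x + y) = Im x + Im y. Proof. by case: x y => ? ? []. Qed.
Lemma Re_mul x y : Re (x * y) = Re x * Re y - Im x * Im y.
Proof. by case: x y => ? ? []. Qed.
Lemma Im_mul x y : Im (x * y) = Re x * Im y + Im x * Re y.
Proof. by case: x y => ? ? []. Qed.
Lemma Re_opp x : Re (- x) = - Re x. Proof. by case: x. Qed.
Lemma Im_opp x : Im (- x) = - Im x. Proof. by case: x. Qed.
Lemma Re_conjc x : Re x^*%C = Re x. Proof. by case: x. Qed.
Lemma Im_conjc x : Im x^*%C = - Im x. Proof. by case: x. Qed.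

Lemma complex_ext x y : Re x = Re y -> Im x = Im y -> x = y.
Proof. by case: x y => ? ? [? ?] /= -> ->. Qed.

(** The squared modulus, with values in R where it can be compared. *)
Definition sqnorm z : R := Re z ^+ 2 + Im z ^+ 2.

Lemma sqnorm_ge0 z : 0 <= sqnorm z. Proof. by rewrite addr_ge0 ?sqr_ge0. Qed.

Lemma sqnormM x y : sqnorm (x * y) = sqnorm x * sqnorm y.
Proof. by rewrite /sqnorm Re_mul Im_mul; ring. Qed.

Lemma sqnormJ z : sqnorm z^*%C = sqnorm z.
Proof. by rewrite /sqnorm Re_conjc Im_conjc sqrrN. Qed.

Lemma mulJ_sqnorm z : z * z^*%C = (sqnorm z)%:C%C.
Proof.
by apply: complex_ext; rewrite ?Re_mul ?Im_mul Re_conjc Im_conjc /= /sqnorm; ring.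
Qed.

Lemma sqnorm_eq0 z : sqnorm z = 0 -> z = 0.
Proof.
move/eqP; rewrite paddr_eq0 ?sqr_ge0 // !sqrf_eq0 => /andP[/eqP a /eqP b].
exact: complex_ext.
Qed.

Lemma norm1_sqnorm z : `|z| = 1 -> sqnorm z = 1.
Proof. by move=> z1; apply: (@complexI R); rewrite add_Re2_Im2 z1 expr1n. Qed.

Lemma sqnormB a b : sqnorm (a - b) = sqnorm a + sqnorm b - 2 * Re (a * b^*%C).
Proof. by case: a b => [a a'] [b b']; rewrite /sqnorm /=; ring. Qed.

Lemma normc_sqnorm z : `|z| = (Num.sqrt (sqnorm z))%:C%C.
Proof. by rewrite normc_def. Qed.

Lemma Re_sqr_le z : Re z ^+ 2 <= sqnorm z.
Proof. by rewrite lerDl sqr_ge0. Qed.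

Lemma Im_sqr_le z : Im z ^+ 2 <= sqnorm z.
Proof. by rewrite lerDr sqr_ge0. Qed.

Lemma Re_Im_lipschitz z : `|Re z| <= Re `|z| /\ `|Im z| <= Re `|z|.
Proof.
rewrite normc_sqnorm /=; split; rewrite -sqrtr_sqr ler_wsqrtr //.
- exact: Re_sqr_le.
- exact: Im_sqr_le.
Qed.

End ComplexNumbers.

Section ComplexLimits.
Variables (R : realType) (I : Type) (p : set_system I).
Context {pU : UltraFilter p}.
Implicit Types (x y : I -> R[i]) (a b c : R[i]).

(** Coordinatewise convergence, which inherits the limit laws of R; [pcvg0P]
    compares it with the topology of the norm. *)
Definition pcvg x c :=
  Re (x i) @[i --> p] --> Re c /\ Im (x i) @[i --> p] --> Im c.

Lemma pcvg_cst c : pcvg (cst c) c.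
Proof. by split; exact: cvg_cst. Qed.

Lemma pcvgD x y a b : pcvg x a -> pcvg y b -> pcvg (fun i => x i + y i) (a + b).
Proof.
move=> [xa xa'] [yb yb']; split; rewrite ?Re_add ?Im_add.
- by under eq_fun do rewrite Re_add; exact: cvgD.
- by under eq_fun do rewrite Im_add; exact: cvgD.
Qed.

Lemma pcvgM x y a b : pcvg x a -> pcvg y b -> pcvg (fun i => x i * y i) (a * b).
Proof.
move=> [xa xa'] [yb yb']; split; rewrite ?Re_mul ?Im_mul.
- by under eq_fun do rewrite Re_mul; apply: cvgB; exact: cvgM.
- by under eq_fun do rewrite Im_mul; apply: cvgD; exact: cvgM.
Qed.

Lemma pcvgZ c x a : pcvg x a -> pcvg (fun i => c * x i) (c * a).
Proof. exact: pcvgM (pcvg_cst c). Qed.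

Lemma pcvgB x y a b : pcvg x a -> pcvg y b -> pcvg (fun i => x i - y i) (a - b).
Proof.
move=> xa /(pcvgZ (-1)) yb; have := pcvgD xa yb.
by under eq_fun do rewrite mulN1r; rewrite mulN1r.
Qed.

Lemma pcvgJ x a : pcvg x a -> pcvg (fun i => (x i)^*%C) a^*%C.
Proof.
move=> [xa xa']; split; rewrite ?Re_conjc ?Im_conjc.
- by under eq_fun do rewrite Re_conjc.
- by under eq_fun do rewrite Im_conjc; exact: cvgN.
Qed.

Lemma pcvg_sum n (x : 'I_n -> I -> R[i]) (a : 'I_n -> R[i]) :
  (forall j, pcvg (x j) (a j)) ->
  pcvg (fun i => \sum_(j < n) x j i) (\sum_(j < n) a j).
Proof.
elim: n x a => [|n IHn] x a xa.
  by under eq_fun do rewrite big_ord0; rewrite big_ord0; exact: pcvg_cst.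
under eq_fun do rewrite big_ord_recr; rewrite big_ord_recr /=.
by apply: pcvgD => //; exact: IHn.
Qed.

Lemma pcvg_unique x a b : pcvg x a -> pcvg x b -> a = b.
Proof.
move=> [xa xa'] [xb xb']; apply: complex_ext.
- exact: (cvg_unique _ xa xb).
- exact: (cvg_unique _ xa' xb').
Qed.

Lemma sqr_le_norm (t M : R) : t ^+ 2 <= M -> `|t| <= M + 1.
Proof. by move=> tM; rewrite ler_norml; apply/andP; split; nra. Qed.

Lemma pcvg_bounded x M : (forall i, sqnorm (x i) <= M) -> exists c, pcvg x c.
Proof.
move=> xM.
have [i|a xa] := @ultra_bounded_cvg R I p (fun i => Re (x i)) (M + 1) pU.
  by apply: sqr_le_norm; exact: le_trans (Re_sqr_le _) (xM i).
have [i|b xb] := @ultra_bounded_cvg R I p (fun i => Im (x i)) (M + 1) pU.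
  by apply: sqr_le_norm; exact: le_trans (Im_sqr_le _) (xM i).
by exists (Complex a b).
Qed.

Lemma eq_pcvg x y c : x =1 y -> pcvg x c -> pcvg y c.
Proof. by move=> /funext ->. Qed.

Lemma cvg_sqr0 (t s : I -> R) : (forall i, t i ^+ 2 <= s i) ->
  s i @[i --> p] --> 0 -> t i @[i --> p] --> 0.
Proof.
move=> ts s0; apply/cvgrPdist_le => e e0; rewrite /=.
have : \forall i \near p, `|0 - s i| <= e ^+ 2.
  by apply: cvgr_dist_le s0 _ _; rewrite exprn_gt0.
apply: filterS => i; rewrite !sub0r !normrN ler_norml => /andP[_ se].
rewrite -(@ler_pXn2r _ 2) ?nnegrE ?(ltW e0) // real_normK ?num_real //.
exact: le_trans se.
Qed.

Lemma pcvg_squeeze0 x (s : I -> R) : (forall i, sqnorm (x i) <= s i) ->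
  s i @[i --> p] --> 0 -> pcvg x 0.
Proof.
move=> xs s0; split=> /=; apply: cvg_sqr0 s0 => i.
- exact: le_trans (Re_sqr_le _) (xs i).
- exact: le_trans (Im_sqr_le _) (xs i).
Qed.

End ComplexLimits.

Section ComplexIntegral.
Context d (T : measurableType d) (R : realType) (mu : probability T R).
Implicit Types f g : T -> R[i].
Local Notation E f := (Rintegral mu setT f).
Local Notation bm := (@bounded_measurable d T R).

Definition cbounded_measurable f :=
  bm (fun x => Re (f x)) /\ bm (fun x => Im (f x)).

Local Notation bmc := cbounded_measurable.

Definition cintegral f : R[i] :=
  Complex (E (fun x => Re (f x))) (E (fun x => Im (f x))).

Definition L2sq f : R := E (fun x => sqnorm (f x)).

Lemma bmc_cst c : bmc (fun=> c).
Proof. by split; exact: bm_cst. Qed.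

Lemma bmcD f g : bmc f -> bmc g -> bmc (fun x => f x + g x).
Proof.
move=> [f1 f2] [g1 g2]; split.
- by under eq_fun do rewrite Re_add; exact: bmD.
- by under eq_fun do rewrite Im_add; exact: bmD.
Qed.

Lemma bmcM f g : bmc f -> bmc g -> bmc (fun x => f x * g x).
Proof.
move=> [f1 f2] [g1 g2]; split.
- by under eq_fun do rewrite Re_mul; apply: bmB; exact: bmM.
- by under eq_fun do rewrite Im_mul; apply: bmD; exact: bmM.
Qed.

Lemma bmcJ f : bmc f -> bmc (fun x => (f x)^*%C).
Proof.
move=> [f1 f2]; split.
- by under eq_fun do rewrite Re_conjc.
- by under eq_fun do rewrite Im_conjc; exact: bmN.
Qed.

Lemma bmcB f g : bmc f -> bmc g -> bmc (fun x => f x - g x).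
Proof.
move=> bf /(bmcM (bmc_cst (-1))) bg; have := bmcD bf bg.
by under eq_fun do rewrite mulN1r.
Qed.

Lemma bmc_sqnorm f : bmc f -> bm (fun x => sqnorm (f x)).
Proof. by move=> [f1 f2]; apply: bmD; exact: bmM. Qed.

Lemma bmc_sum n (F : 'I_n -> T -> R[i]) :
  (forall j, bmc (F j)) -> bmc (fun x => \sum_(j < n) F j x).
Proof.
elim: n F => [|n IHn] F bF.
  by under eq_fun do rewrite big_ord0; exact: bmc_cst.
under eq_fun do rewrite big_ord_recr /=.
by apply: bmcD => //; exact: IHn.
Qed.

Lemma bmc_bounded f : bmc f -> exists M, forall x, sqnorm (f x) <= M.
Proof.
move=> /bmc_sqnorm [_ [M fM]]; exists M => x.
exact: le_trans (ler_norm _) (fM x).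
Qed.

Lemma cintegralD f g : bmc f -> bmc g ->
  cintegral (fun x => f x + g x) = cintegral f + cintegral g.
Proof.
move=> [f1 f2] [g1 g2]; apply: complex_ext; rewrite ?Re_add ?Im_add /= -ED //.
- by under eq_fun do rewrite Re_add.
- by under eq_fun do rewrite Im_add.
Qed.

Lemma cintegralZ c f : bmc f -> cintegral (fun x => c * f x) = c * cintegral f.
Proof.
move=> [f1 f2]; apply: complex_ext; rewrite ?Re_mul ?Im_mul /= -!EZ //.
- by under eq_fun do rewrite Re_mul; rewrite EB //; exact: bmZ.
- by under eq_fun do rewrite Im_mul; rewrite ED //; exact: bmZ.
Qed.

Lemma cintegralB f g : bmc f -> bmc g ->
  cintegral (fun x => f x - g x) = cintegral f - cintegral g.
Proof.
move=> bf bg; have -> : cintegral f - cintegral g =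
    cintegral f + cintegral (fun x => -1 * g x).
  by rewrite cintegralZ // mulN1r.
rewrite -cintegralD //; last exact: bmcM (bmc_cst _) bg.
by congr cintegral; apply/funext => x; rewrite mulN1r.
Qed.

Lemma cintegralJ f : bmc f -> cintegral (fun x => (f x)^*%C) = (cintegral f)^*%C.
Proof.
move=> [f1 f2]; apply: complex_ext; rewrite ?Re_conjc ?Im_conjc /=.
- by under eq_fun do rewrite Re_conjc.
- by under eq_fun do rewrite Im_conjc; rewrite EN.
Qed.

Lemma cintegral_sum n (F : 'I_n -> T -> R[i]) : (forall j, bmc (F j)) ->
  cintegral (fun x => \sum_(j < n) F j x) = \sum_(j < n) cintegral (F j).
Proof.
elim: n F => [|n IHn] F bF.
  rewrite big_ord0; under eq_fun do rewrite big_ord0.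
  by apply: complex_ext; exact: Ecst.
rewrite big_ord_recr /= -IHn // -cintegralD //; last exact: bmc_sum.
by under eq_fun do rewrite big_ord_recr.
Qed.

Lemma cintegral_mulJ f : cintegral (fun x => f x * (f x)^*%C) = (L2sq f)%:C%C.
Proof.
under eq_fun do rewrite mulJ_sqnorm.
by apply: complex_ext => //=; exact: Ecst.
Qed.

Lemma L2sq_ge0 f : 0 <= L2sq f.
Proof. by apply: E_ge0 => x; exact: sqnorm_ge0. Qed.

Lemma sqnorm_cintegral f : bmc f -> sqnorm (cintegral f) <= L2sq f.
Proof.
move=> [f1 f2]; rewrite /L2sq /sqnorm ED; [|exact: bmM|exact: bmM].
by apply: lerD; exact: E_jensen.
Qed.

Lemma L2sq_mul f g M : bmc f -> bmc g -> (forall x, sqnorm (f x) <= M) ->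
  L2sq (fun x => f x * g x) <= M * L2sq g.
Proof.
move=> bf bg fM; rewrite -EZ; last exact: bmc_sqnorm.
apply: le_E => [||x]; first by apply: bmc_sqnorm; exact: bmcM.
- by apply: bmZ; exact: bmc_sqnorm.
- by rewrite sqnormM ler_wpM2r ?sqnorm_ge0.
Qed.

Lemma sqnorm_cintegralM f g M : bmc f -> bmc g -> (forall x, sqnorm (f x) <= M) ->
  sqnorm (cintegral (fun x => f x * g x)) <= M * L2sq g.
Proof.
by move=> bf bg fM; apply: le_trans (sqnorm_cintegral (bmcM bf bg)) _; exact: L2sq_mul.
Qed.

(** By Cauchy-Schwarz, a null vector of L^2 is orthogonal to everything. *)
Lemma cintegral0 f g : bmc f -> bmc g -> L2sq g = 0 -> cintegral (fun x => f x * g x) = 0.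
Proof.
move=> bf bg g0; have [M fM] := bmc_bounded bf; apply: sqnorm_eq0.
apply: le_anti; rewrite sqnorm_ge0 andbT -(mulr0 M) -g0; exact: sqnorm_cintegralM.
Qed.

(** The real and imaginary parts have weak limits by [weak_star_limit]. *)
Lemma weak_limit (I : Type) (p : set_system I) (u : I -> T -> R[i]) :
  UltraFilter p -> (forall i, bmc (u i)) -> (forall i x, sqnorm (u i x) <= 1) ->
  exists phi, bmc phi /\ forall g, bmc g ->
    pcvg p (fun i => cintegral (fun x => u i x * g x)) (cintegral (fun x => phi x * g x)).
Proof.
move=> pU bu u1.
have abs1 (t : R) : t ^+ 2 <= 1 -> `|t| <= 1.
  by move=> t1; rewrite -(@ler_pXn2r _ 2) ?nnegrE // expr1n real_normK ?num_real.
have [a [ba aE]] := @weak_star_limit _ _ _ mu I p (fun i x => Re (u i x)) pU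
  (fun i => (bu i).1.1)
  (fun i x => abs1 _ (le_trans (Re_sqr_le _) (u1 i x))).
have [b [bb bE]] := @weak_star_limit _ _ _ mu I p (fun i x => Im (u i x)) pU
  (fun i => (bu i).2.1)
  (fun i x => abs1 _ (le_trans (Im_sqr_le _) (u1 i x))).
exists (fun x => Complex (a x) (b x)); split=> // g [g1 g2].
split=> /=.
- under eq_fun do under eq_fun do rewrite Re_mul.
  under [X in Rintegral _ _ X]eq_fun do rewrite Re_mul /=.
  rewrite EB; try exact: bmM.
  rewrite (_ : (fun i => _) = fun i => E (fun x => Re (u i x) * Re (g x)) -
     E (fun x => Im (u i x) * Im (g x))); first by apply: cvgB; [exact: aE | exact: bE].
  by apply/funext => i; rewrite EB //; apply: bmM => //; case: (bu i).
- under eq_fun do under eq_fun do rewrite Im_mul.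
  under [X in Rintegral _ _ X]eq_fun do rewrite Im_mul /=.
  rewrite ED; try exact: bmM.
  rewrite (_ : (fun i => _) = fun i => E (fun x => Re (u i x) * Im (g x)) +
     E (fun x => Im (u i x) * Re (g x))); first by apply: cvgD; [exact: aE | exact: bE].
  by apply/funext => i; rewrite ED //; apply: bmM => //; case: (bu i).
Qed.

End ComplexIntegral.

(** * Idempotent ultrafilters *)

Section Idempotent.
Variable p : set_system posnat.
Context {pU : UltraFilter p}.
Hypothesis pp : ultra_add p p = p.

Lemma meet_ex (A B : set posnat) : p A -> p B -> exists n, A n /\ B n.
Proof. by move=> pA pB; apply: (@filter_ex _ p _ (A `&` B)); exact: filterI. Qed.

(** This is the inclusion of p in p + p, by definition of the sum. *)
Lemma idempotent_shift (A : set posnat) :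
  p A -> \forall m \near p, p (shift_set A m).
Proof. by move=> pA; rewrite -pp in pA. Qed.

(** As m >= 1, n > K implies n + m > K + 1. *)
Lemma idempotent_unbounded K : \forall n \near p, (K < val n)%N.
Proof.
elim: K => [|K IHK]; first by apply: nearW => -[].
rewrite /prop_near1 /nbhs /= -pp; apply: nearW => m.
apply: filterS IHK => n Kn; rewrite /shift_set /=.
by have m0 := valP m; rewrite -addn1; exact: leq_add.
Qed.

(** The residue class modulo l on which p concentrates is idempotent in the
    additive group of integers modulo l, hence 0. *)
Lemma idempotent_dvd l : (0 < l)%N -> \forall n \near p, (l %| val n)%N.
Proof.
move=> l0; have [a pa] : exists a, p [set n | (val n %% l)%N = a].
  apply: contrapT => no.
  have ge k : \forall n \near p, (k <= val n %% l)%N.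
    elim: k => [|k IHk]; first exact: nearW.
    have [pk|pk] := in_ultra_setVsetC [set n | (val n %% l)%N = k] pU.
      by case: no; exists k.
    apply: filterS2 IHk pk => n /= kn nk.
    by rewrite ltn_neqAle kn andbT eq_sym; apply/eqP.
  by have /filter_ex [n] := ge l; rewrite leqNgt ltn_pmod.
have [m [/= ma pm]] := meet_ex pa (idempotent_shift pa).
have [n [/= na nma]] := meet_ex pa pm.
apply: filterS pa => k /= ka; rewrite /dvdn ka.
move: nma; rewrite /shift_set /= -modnDm na ma => aa.
have al : (a < l)%N by rewrite -ma ltn_pmod.
have : a + a = a + 0 %[mod l] by rewrite aa addn0 modn_small.
by move/eqP; rewrite eqn_modDl modn_small // mod0n.
Qed.

(** A limit along p = p + p is an iterated limit of the shifted sequence. *)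
Lemma idempotent_cvg (R : realType) (x y : posnat -> R) (c : R) :
  x n @[n --> p] --> c ->
  (\forall m \near p, x (add_posnat n m) @[n --> p] --> y m) ->
  y m @[m --> p] --> c.
Proof.
move=> xc xy; apply/cvgrPdist_le => e e0.
have H : \forall n \near p, `|c - x n| <= e by apply: cvgr_dist_le xc _ e0.
have pA := idempotent_shift H.
apply: filterS2 xy pA => m xym pm.
have cn : `|c - x (add_posnat n m)| @[n --> p] --> `|c - y m|.
  by apply: cvg_norm; apply: cvgB => //; exact: cvg_cst.
exact: (cvg_le_bound cn).
Qed.

Lemma idempotent_pcvg (R : realType) (x y : posnat -> R[i]) (c : R[i]) :
  pcvg p x c ->
  (\forall m \near p, pcvg p (fun n => x (add_posnat n m)) (y m)) ->
  pcvg p y c.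
Proof.
move=> [xc xc'] xy; split.
- by apply: idempotent_cvg xc _; apply: filterS xy => m [].
- by apply: idempotent_cvg xc' _; apply: filterS xy => m [].
Qed.

Lemma increasing_in (B : set posnat) : p B ->
  exists h : nat -> posnat, (forall i, B (h i)) /\
    {homo (fun i => val (h i)) : i j / (i < j)%N}.
Proof.
move=> pB.
have next (m : posnat) : exists h, B h /\ (val m < val h)%N.
  by have [h []] := meet_ex pB (idempotent_unbounded (val m)); exists h.
have [f fP] := choice next; have [h0 Bh0] := filter_ex pB.
exists (fun i => iter i f h0); split=> [[|i]|] //=; first exact: (fP _).1.
by apply: homo_ltn => [? ? ?|i]; [exact: ltn_trans | exact: (fP _).2].
Qed.

End Idempotent.

(** * Differences of integer polynomials *)

Section Shifts.
Implicit Types P Q R : {poly int}.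

(** By Horner's rule, if R is the quotient for Q then Q + R (X + m) is the one for
    Q X + c.  The middle clause computes the coefficient of the quotient in degree
    deg Q - 1. *)
Lemma poly_shift_quotient Q (m : int) : exists R : {poly int},
  [/\ (size R <= (size Q).-1)%N,
      R`_(size Q).-2 = lead_coef Q *+ (size Q).-1 &
      forall n, Q.[n + m] = Q.[n] + m * R.[n]].
Proof.
elim/poly_ind: Q => [|Q c [R [sR lR RE]]].
  exists 0; rewrite !size_poly0 coef0 mulr0n; split=> // n.
  by rewrite !horner0 mulr0 addr0.
have [->|Q0] := eqVneq Q 0.
  exists 0; rewrite mul0r add0r coef0 size_poly0; split=> [//||n].
    by rewrite size_polyC; case: (c != 0); rewrite mulr0n.
  by rewrite !hornerC mulr0 addr0.
have sQ : size (Q * 'X + c%:P) = (size Q).+1 by rewrite size_MXaddC (negPf Q0).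
have sQ0 : (0 < size Q)%N by rewrite size_poly_gt0.
exists (Q + R * ('X + m%:P)); rewrite sQ /=; split=> [||n].
- apply: leq_trans (size_polyD _ _) _; rewrite geq_max leqnn /=.
  apply: leq_trans (size_polyMleq _ _) _; rewrite size_XaddC addn2 /=.
  by rewrite -(prednK sQ0) ltnS.
- have -> : lead_coef (Q * 'X + c%:P) = lead_coef Q.
    rewrite lead_coefE sQ /= coefD coefMX coefC.
    by rewrite (gtn_eqF sQ0) addr0.
  rewrite coefD mulrDr coefD coefMX coefMC (nth_default _ sR) mul0r addr0.
  rewrite -lead_coefE.
  have -> : (if (size Q).-1 == 0%N then 0 else R`_(size Q).-2) =
      lead_coef Q *+ (size Q).-1.
    by rewrite -lR; case: eqP => [e|//]; rewrite lR e mulr0n.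
  by rewrite -mulrS prednK.
- by rewrite !hornerE RE; ring.
Qed.

(** Discrete differentiation lowers the degree by exactly one, since the leading
    coefficient of the quotient is deg Q times that of Q. *)
Lemma poly_shift_diff Q (h1 h2 : int) : (1 < size Q)%N -> h1 != h2 ->
  exists D : {poly int}, size D = (size Q).-1 /\
    forall n, D.[n] = Q.[n + h1] - Q.[n + h2].
Proof.
move=> sQ h12; have [R [sR lR RE]] := poly_shift_quotient Q (h1 - h2).
have {}sR : size R = (size Q).-1.
  apply/eqP; rewrite eqn_leq sR /= leqNgt; apply/negP => lt.
  have lt' : (size R <= (size Q).-2)%N by case: (size Q) lt => [|[|?]].
  move: lR; rewrite nth_default //.
  move/esym/eqP; rewrite mulrn_eq0 lead_coef_eq0 -size_poly_eq0.
  by case: (size Q) sQ => [|[|?]].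
exists ((h1 - h2) *: (R \Po ('X + h2%:P))); split=> [|n].
  by rewrite size_scale ?subr_eq0 // size_comp_poly2 // size_XaddC.
rewrite hornerZ horner_comp !hornerE.
have := RE (n + h2); rewrite (_ : n + h2 + (h1 - h2) = n + h1); last by ring.
by move=> ->; ring.
Qed.

Lemma poly_almost_additive Q (m : int) : Q.[0] = 0 ->
  exists R : {poly int}, [/\ (size R <= (size Q).-1)%N, R.[0] = 0 &
    forall n, Q.[n + m] = Q.[n] + Q.[m] + m * R.[n]].
Proof.
move=> Q0; have [R [sR _ RE]] := poly_shift_quotient Q m.
exists (R - R.[0]%:P); split=> [||n].
- have [->|R0] := eqVneq R 0; first by rewrite horner0 polyC0 subr0 size_poly0.
  apply: leq_trans (size_polyD _ _) _; rewrite geq_max sR size_polyN.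
  apply: leq_trans (size_polyC_leq1 _) _; apply: leq_trans sR.
  by rewrite size_poly_gt0.
- by rewrite !hornerE subrr.
- have := RE 0; rewrite add0r Q0 => ->; rewrite RE hornerD hornerN hornerC; ring.
Qed.

Lemma size_poly_cancel Q R : (size R <= size Q)%N ->
  (size (lead_coef Q *: R - R`_(size Q).-1 *: Q)%R <= (size Q).-1)%N.
Proof.
move=> sR; apply/leq_sizeP => j; rewrite leq_eqVlt => /predU1P[<-|lt].
  by rewrite coefB !coefZ /lead_coef mulrC subrr.
have lt' : (size Q <= j)%N by case: (size Q) lt.
rewrite coefB !coefZ (nth_default _ lt') (nth_default _ (leq_trans sR lt')).
by rewrite !mulr0 subrr.
Qed.

End Shifts.

(** * Rigidity along an idempotent *)

Local Notation bmc := cbounded_measurable.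

(** The functions e k stand for the powers z^k: a group of unimodular functions
    indexed by the integers. *)
Section Characters.
Context d (T : measurableType d) (R : realType) (mu : probability T R).
Variable e : int -> T -> R[i].
Hypothesis e_bmc : forall k, bmc (e k).
Hypothesis eD : forall j k x, e (j + k) x = e j x * e k x.
Hypothesis eN : forall k x, e (- k) x = (e k x)^*%C.
Hypothesis e_sqnorm : forall k x, sqnorm (e k x) = 1.
Variable p : set_system posnat.
Context {pU : UltraFilter p}.
Implicit Types (q : posnat -> int) (f g s : T -> R[i]).

Lemma e0 x : e 0 x = 1.
Proof. by have := eD 1 (- 1) x; rewrite subrr eN mulJ_sqnorm e_sqnorm. Qed.

(** The weak form of the convergence of e (q n) s to s, in which the closure under
    multiplication of s by bounded functions is visible. *)
Definition rigid q s := forall g, bmc g ->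
  pcvg p (fun n => cintegral mu (fun x => e (q n) x * (s x * g x)))
    (cintegral mu (fun x => s x * g x)).

(** Weak convergence to s of functions of the same norm as s: the square of
    e s - s is 2 |s|^2 - 2 Re (e s s^* ), and the integral of the last term tends
    to that of 2 |s|^2. *)
Lemma rigid_strong q s : bmc s -> rigid q s ->
  L2sq mu (fun x => e (q n) x * s x - s x) @[n --> p] --> 0.
Proof.
move=> bs qs; have [lim _] := qs _ (bmcJ bs).
have bss := bmcM bs (bmcJ bs).
have bess n := bmcM (e_bmc (q n)) bss.
rewrite (_ : (fun n => _) = fun n => 2 * L2sq mu s -
    2 * Re (cintegral mu (fun x => e (q n) x * (s x * (s x)^*%C)))).
  rewrite (_ : 0 = 2 * L2sq mu s - 2 * Re (cintegral mu (fun x => s x * (s x)^*%C))).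
    by apply: cvgB; [exact: cvg_cst | apply: cvgM => //; exact: cvg_cst].
  by rewrite cintegral_mulJ /= subrr.
apply/funext => n; transitivity (Rintegral mu setT (fun x =>
    2 * sqnorm (s x) - 2 * Re (e (q n) x * (s x * (s x)^*%C)))).
  congr Rintegral; apply/funext => x.
  by rewrite sqnormB sqnormM e_sqnorm mul1r mulrA; ring.
have [b1 _] := bess n; have b2 := bmc_sqnorm bs.
by rewrite EB ?EZ //; exact: bmZ.
Qed.

Lemma rigid_cvg0 q s (v : posnat -> T -> R[i]) M : bmc s -> rigid q s ->
  (forall n, bmc (v n)) -> (forall n x, sqnorm (v n x) <= M) ->
  pcvg p (fun n => cintegral mu (fun x => v n x * (e (q n) x * s x - s x))) 0.
Proof.
move=> bs qs bv vM; have bd n := bmcB (bmcM (e_bmc (q n)) bs) bs.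
apply: (@pcvg_squeeze0 _ _ _ _ _
  (fun n => M * L2sq mu (fun x => e (q n) x * s x - s x))) => [n|].
  exact: sqnorm_cintegralM.
rewrite -(mulr0 M); apply: cvgM; [exact: cvg_cst | exact: rigid_strong].
Qed.

(** Next to a rigid s, the factor e (q n) is invisible in the limit, even when the
    bounded cofactor v depends on n. *)
Lemma rigid_replace q s (v : posnat -> T -> R[i]) M c : bmc s -> rigid q s ->
  (forall n, bmc (v n)) -> (forall n x, sqnorm (v n x) <= M) ->
  pcvg p (fun n => cintegral mu (fun x => v n x * s x)) c <->
  pcvg p (fun n => cintegral mu (fun x => v n x * (e (q n) x * s x))) c.
Proof.
move=> bs qs bv vM; have lim := rigid_cvg0 bs qs bv vM.
have bes n := bmcM (e_bmc (q n)) bs.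
have eqv n : cintegral mu (fun x => v n x * (e (q n) x * s x - s x)) =
    cintegral mu (fun x => v n x * (e (q n) x * s x)) -
    cintegral mu (fun x => v n x * s x).
  rewrite -cintegralB; [|exact: bmcM|exact: bmcM].
  by congr cintegral; apply/funext => x; rewrite mulrBr.
split=> h.
- rewrite -[c]add0r; apply: eq_pcvg (pcvgD lim h) => n.
  by rewrite eqv subrK.
- rewrite -[c]subr0; apply: eq_pcvg (pcvgB h lim) => n.
  by rewrite eqv opprB addrC subrK.
Qed.

Lemma rigidD q q' s : bmc s -> rigid q s -> rigid q' s ->
  rigid (fun n => q n + q' n) s.
Proof.
move=> bs qs qs' g bg; have [M gM] := bmc_bounded bg.
have bv n := bmcM (e_bmc (q' n)) bg.
rewrite (_ : (fun n => _) = fun n =>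
    cintegral mu (fun x => (e (q' n) x * g x) * (e (q n) x * s x))); last first.
  apply/funext => n; congr cintegral; apply/funext => x; rewrite eD; ring.
apply/(rigid_replace (M := M) _ bs qs bv) => [n x|].
  by rewrite sqnormM e_sqnorm mul1r.
rewrite (_ : (fun n => _) = fun n => cintegral mu (fun x => e (q' n) x * (s x * g x))).
  exact: qs'.
by apply/funext => n; congr cintegral; apply/funext => x; ring.
Qed.

Lemma rigidN q s : bmc s -> rigid q s -> rigid (fun n => - q n) s.
Proof.
move=> bs qs g bg; have [M gM] := bmc_bounded bg.
have bv n := bmcM (e_bmc (- q n)) bg.
rewrite (_ : (fun n => _) = fun n =>
    cintegral mu (fun x => (e (- q n) x * g x) * s x)); last first.
  by apply/funext => n; congr cintegral; apply/funext => x; ring.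
apply/(rigid_replace (M := M) _ bs qs bv) => [n x|].
  by rewrite sqnormM e_sqnorm mul1r.
rewrite (_ : (fun n => _) = cst (cintegral mu (fun x => s x * g x))).
  exact: pcvg_cst.
apply/funext => n; congr cintegral; apply/funext => x.
rewrite (_ : _ * _ = (e (- q n) x * e (q n) x) * (s x * g x)); last by ring.
by rewrite -eD addNr e0 mul1r.
Qed.

Lemma rigid0 s : rigid (fun=> 0) s.
Proof.
move=> g bg; rewrite (_ : (fun n => _) = cst (cintegral mu (fun x => s x * g x))).
  exact: pcvg_cst.
by apply/funext => n; congr cintegral; apply/funext => x; rewrite e0 mul1r.
Qed.

Lemma rigidZ (k : int) q s : bmc s -> rigid q s -> rigid (fun n => k * q n) s.
Proof.
move=> bs qs.
have nat_mul m : rigid (fun n => m%:Z * q n) s.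
  elim: m => [|m IHm]; first by under eq_fun do rewrite mul0r; exact: rigid0.
  by under eq_fun do rewrite intS mulrDl mul1r; exact: rigidD.
case: k => m //; rewrite NegzE; under eq_fun do rewrite mulNr.
exact: rigidN.
Qed.

Lemma rigid_mul q s t : bmc t -> rigid q s -> rigid q (fun x => s x * t x).
Proof.
move=> bt qs g bg.
rewrite (_ : (fun x => s x * t x * g x) = fun x => s x * (t x * g x)).
  by apply: eq_pcvg (qs _ (bmcM bt bg)) => n; congr cintegral; apply/funext => x; ring.
by apply/funext => x; rewrite mulrA.
Qed.

(** Let c be the limit of the integrals of e (q n) w.  For many h, the integral
    of e (q (n + h)) w is close to c in the limit over n, because p is idempotent.
    For K such values of h these functions are pairwise orthogonal in the limit,
    so the square K^2 |c|^2 of the integral of their sum is at most of order K. *)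
Lemma van_der_corput q w : ultra_add p p = p -> bmc w ->
  (forall h1 h2 : posnat, val h1 != val h2 ->
    pcvg p (fun n => cintegral mu (fun x =>
      e (q (add_posnat n h1) - q (add_posnat n h2)) x * (w x * (w x)^*%C))) 0) ->
  pcvg p (fun n => cintegral mu (fun x => e (q n) x * w x)) 0.
Proof.
move=> pp bw dec.
have [M wM] := bmc_bounded bw.
have bew n := bmcM (e_bmc (q n)) bw.
have xM n : sqnorm (cintegral mu (fun x => e (q n) x * w x)) <= L2sq mu w.
  rewrite -[leRHS]mul1r; apply: sqnorm_cintegralM => // x.
  by rewrite e_sqnorm.
have [c xc] := pcvg_bounded (pU := pU) xM.
suff c0 : c = 0 by rewrite c0 in xc.
have shift m : exists b, pcvg p (fun n =>
    cintegral mu (fun x => e (q (add_posnat n m)) x * w x)) b.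
  by apply: (pcvg_bounded (M := L2sq mu w)) => n.
have [y yP] := choice shift.
have yc : pcvg p y c.
  apply: (idempotent_pcvg pp xc); exact: nearW.
(* multiplying by the conjugate of c makes the limit c of the y h real and
   positive, so that sums of many y h can be bounded from below *)
have [lim _] := pcvgZ c^*%C yc.
rewrite mulrC mulJ_sqnorm /= in lim.
apply: sqnorm_eq0; apply/eqP/negPn/negP => c0.
have cpos : 0 < sqnorm c by rewrite lt_def c0 sqnorm_ge0.
have pB : \forall h \near p, sqnorm c / 2 <= Re (c^*%C * y h).
  have e2 : 0 < sqnorm c / 2 by lra.
  have : \forall h \near p, `|sqnorm c - Re (c^*%C * y h)| <= sqnorm c / 2.
    by apply: cvgr_dist_le lim _ e2.
  by apply: filterS => h; rewrite ler_norml; lra.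
have [h [hB h_inc]] := increasing_in pp pB.
have main K : K%:R * sqnorm c <= 4 * L2sq mu w.
  pose a n (i : 'I_K) x := e (q (add_posnat n (h i))) x * w x.
  have ba n i : bmc (a n i) by exact: bmcM.
  pose S n := cintegral mu (fun x => \sum_(i < K) a n i x).
  pose Y := \sum_(i < K) y (h i).
  have limS : pcvg p S Y.
    apply: (eq_pcvg _ (pcvg_sum (fun i : 'I_K => yP (h i)))) => n.
    by rewrite /S cintegral_sum.
  have gram n : cintegral mu (fun x =>
      (\sum_(i < K) a n i x) * (\sum_(i < K) a n i x)^*%C) =
      \sum_(i < K) \sum_(j < K) cintegral mu (fun x =>
        e (q (add_posnat n (h i)) - q (add_posnat n (h j))) x * (w x * (w x)^*%C)).
    have bij i j : bmc (fun x =>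
        e (q (add_posnat n (h i)) - q (add_posnat n (h j))) x * (w x * (w x)^*%C)).
      by apply: bmcM => //; apply: bmcM => //; exact: bmcJ.
    under [RHS]eq_bigr => i _ do rewrite -cintegral_sum //.
    rewrite -cintegral_sum; last by move=> i; exact: bmc_sum.
    congr cintegral; apply/funext => x; rewrite raddf_sum big_distrlr /=.
    apply: eq_bigr => i _; apply: eq_bigr => j _.
    by rewrite /a rmorphM /= eD eN; ring.
  have limN : pcvg p (fun n => cintegral mu (fun x =>
      (\sum_(i < K) a n i x) * (\sum_(i < K) a n i x)^*%C))
      (\sum_(i < K) \sum_(j < K) if i == j then (L2sq mu w)%:C%C else 0).
    apply: (eq_pcvg (fun n => esym (gram n))).
    apply: pcvg_sum => i; apply: pcvg_sum => j.
    case: eqVneq => [->|ij] /=.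
      apply: eq_pcvg (pcvg_cst _) => n /=.
      rewrite -cintegral_mulJ; congr cintegral; apply/funext => x.
      by rewrite subrr e0 mul1r.
    apply: dec; apply/eqP => hij; move: ij; apply/negP; rewrite negbK.
    have inc (k l : nat) : (k < l)%N -> (val (h k) < val (h l))%N by exact: h_inc.
    rewrite -val_eqE /=; case: (ltngtP i j) => // /inc; rewrite hij ltnn //.
  have NY : sqnorm Y <= K%:R * L2sq mu w.
    have [lim' _] := pcvgB limN (pcvgM limS (pcvgJ limS)).
    have : - (K%:R * L2sq mu w - sqnorm Y) <= 0.
      have /cvg_le_bound : - Re (cintegral mu (fun x => (\sum_(i < K) a n i x) *
          (\sum_(i < K) a n i x)^*%C) - S n * (S n)^*%C) @[n --> p] -->
          - (K%:R * L2sq mu w - sqnorm Y).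
        have -> : K%:R * L2sq mu w - sqnorm Y = Re ((\sum_(i < K) \sum_(j < K)
            (if i == j then (L2sq mu w)%:C%C else 0)) - Y * Y^*%C).
          rewrite mulJ_sqnorm Re_add Re_opp /=; congr (_ - _).
          under eq_bigr => i _.
            rewrite -big_mkcond (big_pred1 i); last by move=> j; rewrite eq_sym.
            over.
          by rewrite sumr_const card_ord -raddfMn /= mulr_natl.
        exact: cvgN.
      apply; apply: nearW => n.
      rewrite cintegral_mulJ mulJ_sqnorm Re_add Re_opp /= oppr_le0 subr_ge0.
      by apply: sqnorm_cintegral; exact: bmc_sum.
    by rewrite oppr_le0 subr_ge0.
  have cY : K%:R * (sqnorm c / 2) <= Re (c^*%C * Y).
    rewrite /Y; elim: (K) => [|k IHk]; first by rewrite big_ord0 mulr0 mul0r.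
    rewrite big_ord_recr /= mulrDr Re_add -natr1 mulrDl mul1r.
    by apply: lerD => //; exact: hB.
  have := Re_sqr_le (c^*%C * Y); rewrite sqnormM sqnormJ.
  have [->|K0] := posnP K; first by rewrite mul0r mulr_ge0 ?L2sq_ge0.
  have KR : 0 < K%:R :> R by rewrite ltr0n.
  move=> cY2; have K2 : 0 < K%:R * sqnorm c by exact: mulr_gt0.
  have : (K%:R * sqnorm c) * (K%:R * sqnorm c) <=
      (K%:R * sqnorm c) * (4 * L2sq mu w) by nra.
  by rewrite ler_pM2l.
have := main (Num.truncn (4 * L2sq mu w / sqnorm c)).+1.
by rewrite -ler_pdivlMr // leNgt truncnS_gt.
Qed.

Local Notation I f := (cintegral mu f).

Definition fourier_null g := bmc g /\ forall k, I (fun x => e k x * g x) = 0.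

(** The algebra of multipliers of the orthogonal complement of the trigonometric
    polynomials, closed under conjugation.  It contains the characters and their
    weak limits; its elements are orthogonal to all functions whose Fourier
    coefficients vanish, as [cyclic_fourier_null] states. *)
Definition cyclic f := bmc f /\ forall g, fourier_null g ->
  fourier_null (fun x => f x * g x) /\ fourier_null (fun x => (f x)^*%C * g x).

Definition weak_limit_of q phi := bmc phi /\ forall g, bmc g ->
  pcvg p (fun n => I (fun x => e (q n) x * g x)) (I (fun x => phi x * g x)).

Lemma exists_weak_limit q : exists phi, weak_limit_of q phi.
Proof. by apply: weak_limit => // n x; rewrite e_sqnorm. Qed.

Lemma fourier_null_e k g : fourier_null g -> fourier_null (fun x => e k x * g x).
Proof.
move=> [bg g0]; split=> [|j]; first exact: bmcM.
rewrite -[RHS](g0 (j + k)); congr cintegral; apply/funext => x.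
by rewrite eD mulrA.
Qed.

Lemma cyclicM f g : cyclic f -> cyclic g -> cyclic (fun x => f x * g x).
Proof.
move=> [bf cf] [bg cg]; split=> [|h nh]; first exact: bmcM.
have [h1 h2] := cg _ nh; split.
- have := (cf _ h1).1.
  by under [X in fourier_null X -> _]eq_fun do rewrite mulrA.
- have := (cf _ h2).2.
  rewrite (_ : (fun x => _) = fun x => (f x * g x)^*%C * h x) //.
  by apply/funext => x; rewrite rmorphM /= mulrA.
Qed.

Lemma cyclicJ f : cyclic f -> cyclic (fun x => (f x)^*%C).
Proof.
move=> [bf cf]; split=> [|h nh]; first exact: bmcJ.
have [h1 h2] := cf _ nh; split=> //.
by under eq_fun do rewrite conjcK.
Qed.

Lemma cyclic_e k : cyclic (e k).
Proof.
split=> // g ng; split; first exact: fourier_null_e.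
under eq_fun do rewrite -eN; exact: fourier_null_e.
Qed.

(** The Fourier coefficients of phi g are limits of Fourier coefficients of g. *)
Lemma cyclic_weak_limit q phi : weak_limit_of q phi -> cyclic phi.
Proof.
move=> [bphi phiP]; split=> // g [bg g0]; split; split; try exact: bmcM.
- move=> k.
  rewrite (_ : (fun x => _) = fun x => phi x * (e k x * g x)); last first.
    by apply/funext => x; ring.
  apply: (pcvg_unique (phiP _ (bmcM (e_bmc k) bg))).
  apply: eq_pcvg (pcvg_cst _) => n; rewrite -[LHS](g0 (q n + k)).
  by congr cintegral; apply/funext => x; rewrite eD mulrA.
- by apply: bmcM => //; exact: bmcJ.
- move=> k; have bh := bmcM (e_bmc (- k)) (bmcJ bg).
  rewrite (_ : (fun x => _) = fun x => (phi x * (e (- k) x * (g x)^*%C))^*%C); last first.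
    by apply/funext => x; rewrite !rmorphM /= eN !conjcK; ring.
  rewrite cintegralJ; last exact: bmcM.
  apply: (pcvg_unique (pcvgJ (phiP _ bh))).
  apply: eq_pcvg (pcvg_cst _) => n; rewrite -[LHS](g0 (k - q n)).
  rewrite -cintegralJ; last exact: bmcM.
  by congr cintegral; apply/funext => x; rewrite !rmorphM /= eD !eN !conjcK; ring.
Qed.

Lemma cyclic_fourier_null f g : cyclic f -> fourier_null g -> I (fun x => f x * g x) = 0.
Proof.
move=> [_ cf] ng; have [[_ H] _] := cf _ ng; rewrite -[RHS](H 0).
by congr cintegral; apply/funext => x; rewrite e0 mul1r.
Qed.

Lemma cintegral_eq0 f : bmc f -> L2sq mu f = 0 -> I f = 0.
Proof.
move=> bf f0; have := cintegral0 (bmc_cst T 1) bf f0.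
by under eq_fun do rewrite mul1r.
Qed.

Hypothesis pp : ultra_add p p = p.

Local Notation along Q := (fun n : posnat => (Q : {poly int}).[(val n)%:Z]).

(** In other words phi^2 r = phi r, where phi is the weak limit of e (Q n).  For m
    divisible by l, Q(n + m) - Q(n) - Q(m) is l S(n) with S of lower degree, which
    is invisible on r.  So the iterated limit of e (Q (n + m)) r over n and then m
    is phi^2 r; it is also phi r since p + p = p. *)
Lemma weak_limit_idempotent (Q : {poly int}) phi (l : nat) r g :
  Q.[0] = 0 -> weak_limit_of (along Q) phi -> (0 < l)%N -> bmc r ->
  (forall S : {poly int}, (size S <= (size Q).-1)%N -> S.[0] = 0 ->
     rigid (fun n => l%:Z * S.[(val n)%:Z]) r) -> bmc g ->
  I (fun x => phi x * (phi x * r x * g x)) = I (fun x => phi x * r x * g x).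
Proof.
move=> Q0 [bphi phiP] l0 br rig bg.
have brg := bmcM br bg.
have H1 := phiP _ (bmcM (bmcM bphi br) bg).
apply: (pcvg_unique H1).
have H2 := phiP _ brg.
rewrite (_ : (fun x => _) = fun x => phi x * (r x * g x)); last first.
  by apply/funext => x; rewrite mulrA.
apply: (idempotent_pcvg pp H2).
apply: filterS (idempotent_dvd pp l0) => m /dvdnP [k km].
have [S [sS S0 SE]] := poly_almost_additive (val m)%:Z Q0.
have [M gM] := bmc_bounded bg.
have rS : rigid (fun n => (val m)%:Z * S.[(val n)%:Z]) r.
  have := rig (k%:Z *: S) (leq_trans (size_scale_leq _ _) sS) _.
  rewrite hornerZ S0 mulr0 => /(_ erefl).
  rewrite (_ : (fun n : posnat => _) = fun n => (val m)%:Z * S.[(val n)%:Z]) //.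
  by apply/funext => n; rewrite hornerZ km PoszM; ring.
pose v (n : posnat) x := e Q.[(val n)%:Z] x * (e Q.[(val m)%:Z] x * g x).
have bv n : bmc (v n) by apply: bmcM => //; exact: bmcM.
rewrite (_ : (fun n => _) = fun n =>
    I (fun x => v n x * (e ((val m)%:Z * S.[(val n)%:Z]) x * r x))); last first.
  apply/funext => n; congr cintegral; apply/funext => x.
  by rewrite PoszD SE !eD /v; ring.
apply/(rigid_replace (M := M) _ br rS bv) => [n x|].
  by rewrite !sqnormM !e_sqnorm !mul1r.
rewrite (_ : (fun x => e _ x * _) =
    fun x => phi x * (e Q.[(val m)%:Z] x * (r x * g x))); last first.
  by apply/funext => x; ring.
apply: eq_pcvg (phiP _ (bmcM (e_bmc _) brg)) => n.
by congr cintegral; apply/funext => x; rewrite /v; ring.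
Qed.

(** Induction on the degree of Q.  The function f is there for the induction: the
    difference polynomial produced by [van_der_corput] comes with the weight
    |w|^2 in place of f. *)
Lemma rigid_vector (Q : {poly int}) f : cyclic f ->
  ~ pcvg p (fun n => I (fun x => e Q.[(val n)%:Z] x * f x)) 0 ->
  exists (l : nat) s, [/\ (0 < l)%N, cyclic s, I (fun x => f x * s x) <> 0 &
    forall S : {poly int}, (size S <= size Q)%N -> S.[0] = 0 ->
      rigid (fun n => l%:Z * S.[(val n)%:Z]) s].
Proof.
have [k] := ubnP (size Q); elim: k Q f => // k IHk Q f sQ cf nf.
have bf := cf.1.
have [sQ1|sQ2] := leqP (size Q) 1.
  exists 1%N, (fun x => (f x)^*%C); split=> //; first exact: cyclicJ.
    rewrite cintegral_mulJ => -[f0]; apply: nf; apply: eq_pcvg (pcvg_cst _) => n.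
    by rewrite cintegral0.
  move=> S /leq_trans /(_ sQ1) /size1_polyC ->; rewrite hornerC => ->.
  under eq_fun do rewrite hornerC mulr0.
  exact: rigid0.
pose c := Q.[0]; pose Q0 := Q - c%:P.
have Q00 : Q0.[0] = 0 by rewrite /Q0 !hornerE subrr.
have sQ0 : size Q0 = size Q.
  rewrite /Q0 size_polyDl // size_polyN.
  by apply: leq_ltn_trans sQ2; exact: size_polyC_leq1.
pose f0 x := e c x * f x.
have cf0 : cyclic f0 by apply: cyclicM => //; exact: cyclic_e.
have bf0 := cf0.1.
have [phi lphi] := exists_weak_limit (along Q0).
have cphi := cyclic_weak_limit lphi; have [bphi phiP] := lphi.
(* with this w, the limit of the integral of e (Q0 n) w is the squared L^2 norm
   of phi f0 *)
pose w x := f0 x * (phi x * f0 x)^*%C.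
have bpf : bmc (fun x => phi x * f0 x) by exact: bmcM.
have cw : cyclic w by apply: cyclicM => //; apply: cyclicJ; exact: cyclicM.
have bw := cw.1.
have pf0 : L2sq mu (fun x => phi x * f0 x) <> 0.
  move=> /(cintegral_eq0 bpf) pf; apply: nf.
  have := phiP _ bf0; rewrite pf; apply: eq_pcvg => n; congr cintegral; apply/funext => x.
  by rewrite /f0 mulrA -eD /Q0 !hornerE subrK.
have nw : ~ pcvg p (fun n => I (fun x => e Q0.[(val n)%:Z] x * w x)) 0.
  move=> /(pcvg_unique (phiP _ bw)); rewrite (_ : (fun x => _) = fun x =>
    (phi x * f0 x) * (phi x * f0 x)^*%C); last by apply/funext => x; rewrite /w mulrA.
  by rewrite cintegral_mulJ => -[].
have [h1 [h2 [h12 nD]]] : exists h1 h2 : posnat, val h1 != val h2 /\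
    ~ pcvg p (fun n => I (fun x => e (Q0.[(val (add_posnat n h1))%:Z] -
      Q0.[(val (add_posnat n h2))%:Z]) x * (w x * (w x)^*%C))) 0.
  apply: contrapT => no; apply: nw.
  apply: (van_der_corput (q := along Q0) pp bw) => h1 h2 h12.
  by apply: contrapT => nD; apply: no; exists h1, h2.
have [D [sD DE]] : exists D : {poly int}, size D = (size Q0).-1 /\
    forall n, D.[n] = Q0.[n + (val h1)%:Z] - Q0.[n + (val h2)%:Z].
  by apply: poly_shift_diff; rewrite ?sQ0.
have {}nD : ~ pcvg p (fun n => I (fun x => e D.[(val n)%:Z] x * (w x * (w x)^*%C))) 0.
  by move=> H; apply: nD; apply: eq_pcvg H => n; rewrite DE.
have sDk : (size D < k)%N by rewrite sD sQ0; case: (size Q) sQ sQ2 => [|[]].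
have [l [r [l0 cr nr rigr]]] := IHk D _ sDk (cyclicM cw (cyclicJ cw)) nD.
have br := cr.1.
have {}rigr (S : {poly int}) : (size S <= (size Q0).-1)%N -> S.[0] = 0 ->
    rigid (fun n => l%:Z * S.[(val n)%:Z]) r by rewrite -sD; exact: rigr.
pose s0 x := phi x * r x.
have bs0 : bmc s0 by exact: bmcM.
have fs0 : L2sq mu (fun x => f0 x * s0 x) <> 0.
  move=> H; apply: nr.
  have bt : bmc (fun x => (f0 x)^*%C * f0 x * (phi x * f0 x)^*%C).
    by apply: bmcM; [apply: bmcM => //|]; exact: bmcJ.
  rewrite -[RHS](cintegral0 bt (bmcM bf0 bs0) H); congr cintegral; apply/funext => x.
  by rewrite /w /s0 [(_ * (_ * _)^*%C)^*%C]rmorphM /= conjcK; ring.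
(* phi fixes s0; the factor t makes the integral of f s the squared norm of
   f0 s0 *)
pose t x := (f0 x * s0 x)^*%C * e c x.
have cs0 : cyclic s0 by exact: cyclicM.
have ct : cyclic t by apply: cyclicM; [apply: cyclicJ; exact: cyclicM|exact: cyclic_e].
have bt := ct.1.
pose s x := s0 x * t x.
have cs : cyclic s by exact: cyclicM.
have bs := cs.1.
have rig_low (S : {poly int}) : (size S <= (size Q).-1)%N -> S.[0] = 0 ->
    rigid (fun n => l%:Z * S.[(val n)%:Z]) s.
  rewrite -sQ0 => sS S0.
  rewrite (_ : s = fun x => r x * (phi x * t x)); last first.
    by apply/funext => x; rewrite /s /s0; ring.
  by apply: rigid_mul; [exact: bmcM | exact: rigr].
have rig_top : rigid (fun n => Q0.[(val n)%:Z]) s.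
  apply: rigid_mul => // g bg; have := phiP _ (bmcM bs0 bg).
  by rewrite (weak_limit_idempotent Q00 lphi l0 br rigr bg).
have a0 : lead_coef Q != 0.
  by rewrite lead_coef_eq0 -size_poly_gt0; exact: ltnW.
exists (l * `|lead_coef Q|)%N, s; split=> //.
- by rewrite muln_gt0 l0 absz_gt0.
- rewrite (_ : (fun x => _) = fun x => (f0 x * s0 x) * (f0 x * s0 x)^*%C).
    by rewrite cintegral_mulJ => -[].
  by apply/funext => x; rewrite /s /t /f0; ring.
(* a multiple of Q0 cancels the top coefficient of |a| S *)
- move=> S sS S0; pose a := lead_coef Q0.
  have aE : a = lead_coef Q.
    by rewrite /a /Q0 lead_coefDl // size_polyN (leq_ltn_trans (size_polyC_leq1 _)).
  pose b := S`_(size Q0).-1; pose S' := a *: S - b *: Q0.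
  have sS' : (size S' <= (size Q).-1)%N.
    by rewrite -sQ0; apply: size_poly_cancel; rewrite sQ0.
  have S'0 : S'.[0] = 0 by rewrite /S' hornerD hornerN !hornerZ S0 Q00 !mulr0 subrr.
  have := rigidD bs (rigidZ (sgz a) bs (rig_low _ sS' S'0))
    (rigidZ (sgz a * l%:Z * b) bs rig_top).
  rewrite (_ : (fun n : posnat => _) =
    fun n => (l * `|lead_coef Q|)%N%:Z * S.[(val n)%:Z]) //.
  apply/funext => n; rewrite /S' hornerD hornerN !hornerZ PoszM -aE.
  by rewrite abszEsg; ring.
Qed.

(** A rigid function for Q is fixed by l P, for some l, in the limit; but the
    Fourier coefficients of the weak limit of e (l P n) all vanish. *)
Theorem polynomial_decay_transfer (P Q : {poly int}) :
  P.[0] = 0 -> (size P <= size Q)%N ->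
  (forall (l : nat) (k : int), (0 < l)%N ->
    pcvg p (fun n => I (e (l%:Z * P.[(val n)%:Z] + k))) 0) ->
  pcvg p (fun n => I (e Q.[(val n)%:Z])) 0.
Proof.
move=> P0 PQ H; apply: contrapT => nQ.
have [|l [s [l0 cs ns rigs]]] := @rigid_vector Q (e 0) (cyclic_e 0).
  apply: contra_not nQ; apply: eq_pcvg => n; congr cintegral; apply/funext => x.
  by rewrite e0 mulr1.
have bs := cs.1.
have [phi [bphi phiP]] := exists_weak_limit (fun n => l%:Z * P.[(val n)%:Z]).
have nphi : fourier_null phi.
  split=> // k; under eq_fun do rewrite mulrC.
  apply: (pcvg_unique (phiP _ (e_bmc k))); apply: eq_pcvg (H l k l0) => n.
  by congr cintegral; apply/funext => x; rewrite eD.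
have := pcvg_unique (rigs P PQ P0 _ (bmc_cst T 1)) (phiP _ (bmcM bs (bmc_cst T 1))).
move=> sphi; apply: ns; rewrite -[RHS](cyclic_fourier_null cs nphi).
transitivity (I (fun x => s x * 1)).
  by congr cintegral; apply/funext => x; rewrite e0 mulrC.
by rewrite sphi; congr cintegral; apply/funext => x; ring.
Qed.

End Characters.

(** * Characters of the circle *)

Section Circle.
Variable R : realType.

Lemma pcvg0P (I : Type) (p : set_system I) (x : I -> R[i]^o) :
  UltraFilter p -> pcvg p (x : I -> R[i]) 0 <-> x i @[i --> p] --> (0 : R[i]^o).
Proof.
move=> pU; split=> [[xr xi]|x0].
- have n0 : sqnorm (x i : R[i]) @[i --> p] --> (0 : R).
    rewrite (_ : 0 = 0 * 0 + 0 * 0); last by rewrite mulr0 addr0.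
    by apply: cvgD; apply: cvgM.
  apply/cvgrPdist_le => eps eps0.
  have er : eps = (Re eps)%:C%C by rewrite RRe_real // gtr0_real.
  have e0 : 0 < Re eps by rewrite -ltcR -er.
  have : \forall i \near p, `|0 - sqnorm (x i : R[i])| <= Re eps ^+ 2.
    by apply: cvgr_dist_le n0 _ _; rewrite exprn_gt0.
  apply: filterS => i; rewrite !sub0r !normrN ger0_norm ?sqnorm_ge0 // => le.
  rewrite normc_sqnorm er lecR.
  by rewrite -[leRHS]ger0_norm ?(ltW e0) // -sqrtr_sqr ler_wsqrtr.
- have n0 : sqnorm (x i : R[i]) @[i --> p] --> (0 : R).
    apply/cvgrPdist_le => eps eps0.
    have s0 : 0 < (Num.sqrt eps)%:C%C :> R[i] by rewrite ltcR sqrtr_gt0.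
    have : \forall i \near p, `|0 - x i| <= (Num.sqrt eps)%:C%C.
      by apply: cvgr_dist_le x0 _ s0.
    apply: filterS => i; rewrite !sub0r !normrN normc_sqnorm lecR.
    by rewrite ger0_norm ?sqnorm_ge0 // ler_sqrt // ltW.
  exact: pcvg_squeeze0 n0.
Qed.

(** The superlevel sets are open, hence Borel. *)
Lemma continuous_measurable_S1 (f : S1 R -> R) :
  continuous f -> measurable_fun (setT : set (borelS1 R)) f.
Proof.
move=> cf; apply: (measurability _ (RGenOInfty.measurableE R)) => //.
move=> /= _ [_ [a ->] <-]; rewrite setTI; apply: sub_sigma_algebra.
by move/continuousP : cf; apply; exact: rray_open.
Qed.

Lemma continuous_Re : continuous (fun z : R[i]^o => Re (z : R[i])).
Proof.
move=> z; have nF : Filter (nbhs (z : R[i]^o)) by exact: nbhs_filter.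
apply/(cvgrPdist_le _ (F := nbhs (z : R[i]^o))) => eps eps0.
have eps0C : 0 < eps%:C%C :> R[i] by rewrite ltcR.
have : nbhs (z : R[i]^o) (ball (z : R[i]^o) eps%:C%C) by exact: nbhsx_ballx.
apply: filterS => w /ltW; rewrite normc_sqnorm lecR; apply: le_trans.
have [h _] := Re_Im_lipschitz (z - w : R[i]); move: h.
by rewrite normc_sqnorm Re_add Re_opp.
Qed.

Lemma continuous_Im : continuous (fun z : R[i]^o => Im (z : R[i])).
Proof.
move=> z; have nF : Filter (nbhs (z : R[i]^o)) by exact: nbhs_filter.
apply/(cvgrPdist_le _ (F := nbhs (z : R[i]^o))) => eps eps0.
have eps0C : 0 < eps%:C%C :> R[i] by rewrite ltcR.
have : nbhs (z : R[i]^o) (ball (z : R[i]^o) eps%:C%C) by exact: nbhsx_ballx.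
apply: filterS => w /ltW; rewrite normc_sqnorm lecR; apply: le_trans.
have [_ h] := Re_Im_lipschitz (z - w : R[i]); move: h.
by rewrite normc_sqnorm Im_add Im_opp.
Qed.

Lemma continuous_set_val : continuous (set_val : S1 R -> R[i]^o).
Proof. exact: initial_continuous. Qed.

Local Notation zeta := (fun z : borelS1 R => (set_val (z : S1 R) : R[i])).

Lemma sqnorm_zeta z : sqnorm (zeta z) = 1.
Proof. by apply: norm1_sqnorm; have := set_valP (z : S1 R). Qed.

Lemma zeta_neq0 z : zeta z != 0.
Proof.
apply/eqP => z0; have := sqnorm_zeta z; rewrite /= z0 /sqnorm /= expr0n addr0.
by move/eqP; rewrite eq_sym oner_eq0.
Qed.

Lemma bmc_zeta : bmc zeta.
Proof.
split; split.
- apply: (continuous_measurable_S1 (f := fun z => Re (set_val z : R[i]))) => z.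
  apply: (@continuous_comp (S1 R) R[i]^o R set_val (fun w => Re (w : R[i])) z).
    exact: continuous_set_val.
  exact: continuous_Re.
- by exists (1 + 1) => z; apply: sqr_le_norm; rewrite -(sqnorm_zeta z) Re_sqr_le.
- apply: (continuous_measurable_S1 (f := fun z => Im (set_val z : R[i]))) => z.
  apply: (@continuous_comp (S1 R) R[i]^o R set_val (fun w => Im (w : R[i])) z).
    exact: continuous_set_val.
  exact: continuous_Im.
- by exists (1 + 1) => z; apply: sqr_le_norm; rewrite -(sqnorm_zeta z) Im_sqr_le.
Qed.

Definition character (k : int) (z : borelS1 R) : R[i] := zeta z ^ k.

Lemma characterD j k z : character (j + k) z = character j z * character k z.
Proof. by rewrite /character expfzDr ?zeta_neq0. Qed.

Lemma sqnorm_character k z : sqnorm (character k z) = 1.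
Proof.
have nat_case (n : nat) : sqnorm (character n z) = 1.
  elim: n => [|n IHn]; first by rewrite /character expr0z /sqnorm /= expr1n expr0n addr0.
  by rewrite -addn1 PoszD characterD sqnormM IHn mul1r /character expr1z sqnorm_zeta.
case: k => [//|n].
have := characterD (Negz n) n.+1 z; rewrite NegzE addNr /character expr0z.
move/(congr1 (@sqnorm R)); rewrite sqnormM nat_case mulr1 => <-.
by rewrite /sqnorm /= expr1n expr0n addr0.
Qed.

Lemma characterN k z : character (- k) z = (character k z)^*%C.
Proof.
have := characterD k (- k) z; rewrite subrr {1}/character expr0z => h.
rewrite -[LHS]mul1r -[X in X * _](_ : (character k z)^*%C * character k z = 1).
  by rewrite -mulrA -h mulr1.
by rewrite mulrC mulJ_sqnorm sqnorm_character.
Qed.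

Lemma bmc_character k : bmc (character k).
Proof.
have nat_case (n : nat) : bmc (character n).
  elim: n => [|n IHn].
    rewrite (_ : character _ = fun=> 1); first exact: bmc_cst.
    by apply/funext => z; rewrite /character expr0z.
  rewrite (_ : character _ = fun z => character n z * zeta z).
    by apply: bmcM => //; exact: bmc_zeta.
  by apply/funext => z; rewrite -addn1 PoszD characterD /character expr1z.
case: k => [//|n]; rewrite NegzE.
rewrite (_ : character _ = fun z => (character n.+1 z)^*%C); first exact: bmcJ.
by apply/funext => z; exact: characterN.
Qed.

End Circle.

Lemma fourier_pcvg0 (R : realType) (sigma : probability (borelS1 R) R)
    (p : set_system posnat) (q : posnat -> int) : UltraFilter p ->
  pcvg p (fun n => cintegral sigma (character (q n))) 0 <->
  fourier sigma (q n) @[n --> p] --> (0 : R[i]^o).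
Proof. by move=> pU; exact: pcvg0P. Qed.

Unset Implicit Arguments.

Theorem corollaryD (R : realType) (sigma : probability (borelS1 R) R)
    (p : set_system posnat) :
  continuous_measure sigma -> UltraFilter p -> ultra_add p p = p ->
  ((forall (l : nat) (k : int), (1 <= l)%N ->
      fourier sigma (l%:Z * (val n)%:Z + k) @[n --> p] --> 0) ->
    forall Q : {poly int}, (1 < size Q)%N ->
      fourier sigma Q.[(val n)%:Z] @[n --> p] --> 0)
  /\
  (forall (N : nat) (P : {poly int}), (1 <= N)%N -> polys_le N P ->
    (forall (l : nat) (k : int), (1 <= l)%N ->
      fourier sigma (l%:Z * P.[(val n)%:Z] + k) @[n --> p] --> 0) ->
    forall Q : {poly int}, (size P <= size Q)%N ->
      fourier sigma Q.[(val n)%:Z] @[n --> p] --> 0).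
Proof.
move=> _ pU pp.
have main (P : {poly int}) : P.[0] = 0 ->
    (forall (l : nat) (k : int), (1 <= l)%N ->
      fourier sigma (l%:Z * P.[(val n)%:Z] + k) @[n --> p] --> (0 : R[i]^o)) ->
    forall Q : {poly int}, (size P <= size Q)%N ->
      fourier sigma Q.[(val n)%:Z] @[n --> p] --> (0 : R[i]^o).
  move=> P0 H Q PQ; apply/fourier_pcvg0.
  apply: (polynomial_decay_transfer (@bmc_character R) (@characterD R) (@characterN R)
    (@sqnorm_character R) pp P0 PQ) => l k l0.
  by apply/fourier_pcvg0; exact: H.
split=> [H Q sQ|N P _ [P0 _] H Q]; last exact: main.
apply: (main 'X); rewrite ?hornerX ?size_polyX // => l k l0.
by under eq_fun do rewrite hornerX; exact: H.
Qed.
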